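(* Let $(A,\mu,T)$ be a Rota-Baxter algebra of weight $\lambda$, with $A$ regarded as a graded space concentrated in degree $0$. Let $\alpha=(m,\tau)$, $m=-s\circ\mu\circ(s^{-1}\otimes s^{-1})$, $\tau=T\circ s^{-1}$, be the Maurer-Cartan element of the $L_\infty$-algebra $\mathfrak{C}_{\mathrm{RBA}_\lambda}(A)$ corresponding to this Rota-Baxter algebra structure, and twist $\mathfrak{C}_{\mathrm{RBA}_\lambda}(A)$ by $\alpha$. Then the underlying complex $(\mathfrak{C}_{\mathrm{RBA}_\lambda}(A),l_1^\alpha)$ of the twisted $L_\infty$-algebra is exactly $s\mathrm{C}^\bullet_{\mathrm{RBA}_\lambda}(A)$, the shift of the cochain complex of the Rota-Baxter algebra $(A,\mu,T)$, under the identifications $\mathrm{Hom}((sA)^{\otimes n},sA)\cong\mathrm{Hom}(A^{\otimes n},A)$, $f\mapsto s^{-1}\circ f\circ s^{\otimes n}$, and $\mathrm{Hom}((sA)^{\otimes n},A)\cong\mathrm{Hom}(A^{\otimes n},A)$, $g\mapsto g\circ s^{\otimes n}$.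
   Context: **Conventions.** $\mathbf{k}$ is a field of characteristic $0$, $\lambda\in\mathbf{k}$; all spaces, tensor products, Hom-spaces are over $\mathbf{k}$. A Rota-Baxter algebra of weight $\lambda$ is $(A,\mu=\cdot,T)$ with $(A,\mu)$ associative and $T:A\to A$ linear with $T(a)T(b)=T(aT(b)+T(a)b+\lambda ab)$. Write $a_{i,j}=a_i\otimes\cdots\otimes a_j$ (empty if $i>j$). **Cochain complex of $(A,\mu,T)$.** Let $\mathrm{C}^n_{\mathrm{Alg}}(A)=\mathrm{C}^n_{\mathrm{RBO}_\lambda}(A)=\mathrm{Hom}(A^{\otimes n},A)$, $n\geqslant0$. - $\delta^n(f)(a_{1,n+1})=(-1)^{n+1}a_1f(a_{2,n+1})+\sum_{i=1}^n(-1)^{n-i+1}f(a_{1,i-1}\otimes a_ia_{i+1}\otimes a_{i+2,n+1})+f(a_{1,n})a_{n+1}$. - With $a\star b=aT(b)+T(a)b+\lambda ab$, $a\rhd x=T(a)x-T(ax)$, $x\lhd a=xT(a)-T(xa)$: $\partial^n(f)(a_{1,n+1})=(-1)^{n+1}a_1\rhd f(a_{2,n+1})+\sum_{i=1}^n(-1)^{n-i+1}f(a_{1,i-1}\otimes a_i\star a_{i+1}\otimes a_{i+2,n+1})+f(a_{1,n})\lhd a_{n+1}$. - $\Phi^0=\mathrm{Id}$ and for $n\geqslant1$: $\Phi^n(f)(a_{1,n})=f(T(a_1)\otimes\cdots\otimes T(a_n))-\sum_{k=0}^{n-1}\lambda^{n-k-1}\sum_{1\leqslant i_1<\cdots<i_k\leqslant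 n}T\circ f(a_{1,i_1-1}\otimes T(a_{i_1})\otimes a_{i_1+1,i_2-1}\otimes T(a_{i_2})\otimes\cdots\otimes T(a_{i_k})\otimes a_{i_k+1,n})$. - $\mathrm{C}^0_{\mathrm{RBA}_\lambda}(A)=\mathrm{C}^0_{\mathrm{Alg}}(A)$, $\mathrm{C}^n_{\mathrm{RBA}_\lambda}(A)=\mathrm{C}^n_{\mathrm{Alg}}(A)\oplus\mathrm{C}^{n-1}_{\mathrm{RBO}_\lambda}(A)$ for $n\geqslant1$, with $d^n(f,g)=(\delta^n(f),-\partial^{n-1}(g)-\Phi^n(f))$. The piece of cohomological degree $n$ is placed in homological degree $-n$; the shift $s\mathrm{C}^\bullet$ raises homological degree by $1$ and has differential $-d$. **Graded conventions.** Homological grading; $(sV)_n=V_{n-1}$; $s$ has degree $1$, $s^{-1}$ degree $-1$; $sf:=s\circ f$, $|sf|=|f|+1$; Koszul rule, e.g. $(f\otimes g)(v\otimes w)=(-1)^{|g||v|}f(v)\otimes g(w)$. $T^c(sV)=\bigoplus_{n\geqslant0}(sV)^{\otimes n}$. For $\sigma\in S_n$, $\epsilon(\sigma;x_1,\dots,x_n)$ is defined by $x_1\odot\cdots\odot x_n=\epsilon(\sigma;x_1,\dots,x_n)x_{\sigma(1)}\odot\cdots\odot x_{\sigma(n)}$ in the graded symmetric algebra; $\chi=\mathrm{sgn}(\sigma)\epsilon$. **Twisting.** In an $L_\infty$-algebra $(L,\{l_n\})$ ($|l_n|=n-2$), $\alpha\in L_{-1}$ is Maurer-Cartan if $\sum_{n\geqslant1}\frac1{n!}(-1)^{n(n-1)/2}l_n(\alpha^{\otimes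 n})=0$; the twisted operations are $l^\alpha_n(x_1\otimes\cdots\otimes x_n)=\sum_{i\geqslant0}\frac1{i!}(-1)^{in+\frac{i(i-1)}2}l_{n+i}(\alpha^{\otimes i}\otimes x_1\otimes\cdots\otimes x_n)$ (when these sums exist). **Braces.** For homogeneous $f\in\mathrm{Hom}((sV)^{\otimes m},V)$, $g_i\in\mathrm{Hom}((sV)^{\otimes l_i},V)$, $u=m+l_1+\cdots+l_n-n$: $$sf\{sg_1,\dots,sg_n\}(sa_{1,u})=\sum_{0\leqslant i_1\leqslant i_1+l_1\leqslant i_2\leqslant\cdots\leqslant i_n+l_n\leqslant u}(-1)^{\xi}sf\big(sa_{1,i_1}\otimes sg_1(sa_{i_1+1,i_1+l_1})\otimes sa_{i_1+l_1+1,i_2}\otimes\cdots\otimes sg_n(sa_{i_n+1,i_n+l_n})\otimes sa_{i_n+l_n+1,u}\big),$$ where $sa_{i,j}=sa_i\otimes\cdots\otimes sa_j$, $\xi=\sum_{k}(|g_k|+1)\sum_{j=1}^{i_k}(|a_j|+1)$; it is $0$ if $n>m$, and $sf\{\}=sf$. $[sf,sg]_G=sf\{sg\}-(-1)^{(|f|+1)(|g|+1)}sg\{sf\}$. **The $L_\infty$-algebra.** For a graded space $V$: $\mathfrak{C}_{\mathrm{Alg}}(V)=\mathrm{Hom}(T^c(sV),sV)$, $\mathfrak{C}_{\mathrm{RBO}_\lambda}(V)=\mathrm{Hom}(T^c(sV),V)$, $\mathfrak{C}_{\mathrm{RBA}_\lambda}(V)=\mathfrak{C}_{\mathrm{Alg}}(V)\oplus\mathfrak{C}_{\mathrm{RBO}_\lambda}(V)$,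 with operations given on homogeneous elements of fixed arity and extended multilinearly: (I) For $sh\in\mathrm{Hom}(\mathbf{k},sV)$, $h\in V$: $l_1(sh)=h\in\mathrm{Hom}(\mathbf{k},V)\subset\mathfrak{C}_{\mathrm{RBO}_\lambda}(V)$. (II) For $sf,sh\in\mathfrak{C}_{\mathrm{Alg}}(V)$: $l_2(sf\otimes sh)=[sf,sh]_G$. (III)(i) For $n\geqslant1$, $sh\in\mathrm{Hom}((sV)^{\otimes n},sV)$, $g_1,\dots,g_n\in\mathfrak{C}_{\mathrm{RBO}_\lambda}(V)$: $l_{n+1}(sh\otimes g_1\otimes\cdots\otimes g_n)=\sum_{\sigma\in S_n}(-1)^{\eta}\big(h\circ(sg_{\sigma(1)}\otimes\cdots\otimes sg_{\sigma(n)})-(-1)^{(|g_{\sigma(1)}|+1)(|h|+1)}s^{-1}(sg_{\sigma(1)})\{sh\{sg_{\sigma(2)},\dots,sg_{\sigma(n)}\}\}\big)$, with $(-1)^\eta=\chi(\sigma;g_1,\dots,g_n)(-1)^{n(|h|+1)+\sum_{k=1}^{n-1}\sum_{j=1}^k|g_{\sigma(j)}|}$. (III)(ii) For $n\geqslant2$, $1\leqslant m\leqslant n-1$, $sh\in\mathrm{Hom}((sV)^{\otimes n},sV)$, $g_1,\dots,g_m\in\mathfrak{C}_{\mathrm{RBO}_\lambda}(V)$: $l_{m+1}(sh\otimes g_1\otimes\cdots\otimes g_m)=\sum_{\sigma\in S_m}(-1)^{\xi}\lambda^{n-m}s^{-1}(sg_{\sigma(1)})\{sh\{sg_{\sigma(2)},\dots,sg_{\sigma(m)}\}\}$,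 with $(-1)^\xi=\chi(\sigma;g_1,\dots,g_m)(-1)^{1+m(|h|+1)+\sum_{k=1}^{m-1}\sum_{j=1}^k|g_{\sigma(j)}|+(|h|+1)(|g_{\sigma(1)}|+1)}$. (IV) For $1\leqslant k\leqslant m\leqslant n$: $l_{m+1}(g_1\otimes\cdots\otimes g_k\otimes sh\otimes g_{k+1}\otimes\cdots\otimes g_m)=(-1)^{(|h|+1)(\sum_{j=1}^k|g_j|)+k}l_{m+1}(sh\otimes g_1\otimes\cdots\otimes g_m)$, with $sh$ of arity $n$. (V) All other components vanish. *)

(* Defs.v *)
From HB Require Import structures.
From mathcomp Require Import all_boot all_order all_fingroup all_algebra.
From mathcomp Require Import boolp functions.

Set Implicit Arguments.
Unset Strict Implicit.
Unset Printing Implicit Defensive.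

Import GRing.Theory.
Local Open Scope ring_scope.

Definition graded (k : fieldType) := int -> lmodType k.

Definition helt (k : fieldType) (V : graded k) : Type := {d : int & V d}.

Definition tdeg (k : fieldType) (V : graded k) (xs : seq (helt V)) : int :=
  \sum_(x <- xs) tag x.

(* Families of one vector in each degree. An element of V_e is the family
   supported in degree e; multilinear maps below take values in this module,
   so that no transport along equalities of degrees is needed to add or
   compose them. *)
Definition gtot (k : fieldType) (V : graded k) : Type := forall e : int, V e.

HB.instance Definition _ (k : fieldType) (V : graded k) :=
  gen_eqMixin (gtot V).
HB.instance Definition _ (k : fieldType) (V : graded k) :=
  gen_choiceMixin (gtot V).

Section GtotModule.
Variables (k : fieldType) (V : graded k).
Implicit Types u v w : gtot V.

Let zero : gtot V := fun _ => 0.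
Let opp u : gtot V := fun e => - u e.
Let add u v : gtot V := fun e => u e + v e.
Let scale (c : k) u : gtot V := fun e => c *: u e.

Let addA : associative add.
Proof. by move=> u v w; apply: functional_extensionality_dep => e; exact: addrA. Qed.
Let addC : commutative add.
Proof. by move=> u v; apply: functional_extensionality_dep => e; exact: addrC. Qed.
Let add0 : left_id zero add.
Proof. by move=> u; apply: functional_extensionality_dep => e; exact: add0r. Qed.
Let addN : left_inverse zero opp add.
Proof. by move=> u; apply: functional_extensionality_dep => e; exact: addNr. Qed.

HB.instance Definition _ :=
  GRing.isZmodule.Build (gtot V) addA addC add0 addN.

Let scaleA a b v : scale a (scale b v) = scale (a * b) v.
Proof. by apply: functional_extensionality_dep => e; exact: scalerA. Qed.
Let scale1 : left_id 1 scale.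
Proof. by move=> u; apply: functional_extensionality_dep => e; exact: scale1r. Qed.
Let scaleDr : right_distributive scale +%R.
Proof. by move=> c u v; apply: functional_extensionality_dep => e; exact: scalerDr. Qed.
Let scaleDl v : {morph scale^~ v : a b / a + b}.
Proof. by move=> a b; apply: functional_extensionality_dep => e; exact: scalerDl. Qed.

HB.instance Definition _ :=
  GRing.Zmodule_isLmodule.Build k (gtot V) scaleA scale1 scaleDr scaleDl.
End GtotModule.

Definition at_deg (k : fieldType) (V : graded k) (d : int) (v : gtot V) :
  helt V := Tagged V (v d).

(* Raw functions representing Hom(T^c(U), W): the restriction to lists of
   length n is the component on U^{(x)n}. The actual graded Hom space is cut
   out by is_hom. *)
Definition homT (k : fieldType) (U W : graded k) : Type :=
  seq (helt U) -> gtot W.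

HB.instance Definition _ (k : fieldType) (U W : graded k) :=
  GRing.Lmodule.copy (homT U W) (seq (helt U) -> gtot W).

Definition is_hom (k : fieldType) (U W : graded k) (p : int) (F : homT U W) :
  Prop :=
  (forall (xs ys : seq (helt U)) (d e : int),
     linear (fun x : U d => F (xs ++ Tagged U x :: ys) e)) /\
  (forall (xs : seq (helt U)) (e : int), e != p + tdeg xs -> F xs e = 0).

Definition arity (k : fieldType) (U W : graded k) (n : nat) (F : homT U W) :
  homT U W := fun xs => if size xs == n then F xs else 0.

(* The value of a map of degree p, as a homogeneous element of W. *)
Definition hval (k : fieldType) (U W : graded k) (p : int) (F : homT U W)
  (xs : seq (helt U)) : helt W := at_deg (p + tdeg xs) (F xs).

Definition shift (k : fieldType) (V : graded k) : graded k :=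
  fun n => V (n - 1).

(* s and s^{-1} on homogeneous elements and on families. *)
Definition susp_elt (k : fieldType) (V : graded k) (x : helt V) :
  helt (shift V) :=
  @Tagged int (tag x + 1) (shift V)
    (ecast d (V d) (esym (addrK 1 (tag x))) (tagged x)).

Definition desusp_elt (k : fieldType) (V : graded k) (x : helt (shift V)) :
  helt V := @Tagged int (tag x - 1) V (tagged x).

Definition susp (k : fieldType) (V : graded k) (v : gtot V) :
  gtot (shift V) := fun d => v (d - 1).

Definition desusp (k : fieldType) (V : graded k) (v : gtot (shift V)) :
  gtot V := fun e => ecast d (V d) (addrK 1 e) (v (e + 1)).

(* Each g_i is paired with its degree. The argument pre holds the
   arguments of f collected so far and c is the total degree of those inputs
   that precede the remaining list xs. The next g is applied to the l inputs
   following the first i of xs; summing over l as well as i extends the braces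
   multilinearly to maps having components of several arities, and the case of
   more g's than the arity of f gives 0 since f is applied to a list of the
   wrong length. *)
Fixpoint brace_rec (k : fieldType) (U W : graded k) (f : homT U W)
  (pre : seq (helt U)) (c : int) (gs : seq (int * homT U U))
  (xs : seq (helt U)) : gtot W :=
  match gs with
  | [::] => f (pre ++ xs)
  | (q, g) :: gs' =>
      \sum_(i < (size xs).+1) \sum_(l < (size xs - i).+1)
        (-1 : k) ^ (q * (c + tdeg (take i xs))) *:
        brace_rec f (pre ++ take i xs ++ [:: hval q g (take l (drop i xs))])
          (c + tdeg (take (i + l) xs)) gs' (drop (i + l) xs)
  end.

Definition brace (k : fieldType) (U W : graded k) (f : homT U W)
  (gs : seq (int * homT U U)) : homT U W :=
  fun xs => brace_rec f [::] 0 gs xs.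

(* f o (g_1 (x) ... (x) g_n), with the Koszul sign rule. *)
Fixpoint tcomp_rec (k : fieldType) (U W : graded k) (f : homT U W)
  (pre : seq (helt U)) (c : int) (gs : seq (int * homT U U))
  (xs : seq (helt U)) : gtot W :=
  match gs with
  | [::] => if nilp xs then f pre else 0
  | (q, g) :: gs' =>
      \sum_(l < (size xs).+1)
        (-1 : k) ^ (q * c) *:
        tcomp_rec f (rcons pre (hval q g (take l xs)))
          (c + tdeg (take l xs)) gs' (drop l xs)
  end.

Definition tcomp (k : fieldType) (U W : graded k) (f : homT U W)
  (gs : seq (int * homT U U)) : homT U W :=
  fun xs => tcomp_rec f [::] 0 gs xs.

Definition gerstenhaber (k : fieldType) (U : graded k)
  (f g : int * homT U U) : homT U U :=
  brace f.2 [:: g] - (-1 : k) ^ (f.1 * g.1) *: brace g.2 [:: f].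

Definition permute (X : Type) (gs : seq X) (sigma : 'S_(size gs)) : seq X :=
  [seq tnth (in_tuple gs) (sigma i) | i <- enum 'I_(size gs)].

(* The sign epsilon with x_1 ... x_n = epsilon x_sigma(1) ... x_sigma(n) in the
   graded symmetric algebra: each inversion of sigma contributes the sign of
   the transposition of the two elements involved. *)
Definition koszul (k : fieldType) (n : nat) (deg : 'I_n -> int)
  (sigma : 'S_n) : k :=
  \prod_(i < n) \prod_(j < n | (i < j)%N && (sigma j < sigma i)%N)
    (-1) ^ (deg (sigma i) * deg (sigma j)).

Definition antikoszul (k : fieldType) (n : nat) (deg : 'I_n -> int)
  (sigma : 'S_n) : k := (-1) ^+ sigma * koszul k deg sigma.

Definition C_Alg (k : fieldType) (V : graded k) : Type :=
  homT (shift V) (shift V).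
Definition C_RBO (k : fieldType) (V : graded k) : Type := homT (shift V) V.

HB.instance Definition _ (k : fieldType) (V : graded k) :=
  GRing.Lmodule.copy (C_Alg V) (homT (shift V) (shift V)).
HB.instance Definition _ (k : fieldType) (V : graded k) :=
  GRing.Lmodule.copy (C_RBO V) (homT (shift V) V).

Definition C_RBA (k : fieldType) (V : graded k) : lmodType k :=
  (C_Alg V * C_RBO V)%type.

Definition in_RBA (k : fieldType) (V : graded k) (p : int) (x : C_RBA V) :
  Prop := is_hom p x.1 /\ is_hom p x.2.

Definition susp_hom (k : fieldType) (V : graded k) (g : int * C_RBO V) :
  int * C_Alg V := (g.1 + 1, fun xs => susp (g.2 xs)).

Definition desusp_hom (k : fieldType) (V : graded k) (f : C_Alg V) : C_RBO V :=
  fun xs => desusp (f xs).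

(* l_{m+1}(sh (x) g_1 (x) ... (x) g_m) for sh of arity n and degree
   p = |h| + 1, and m > 0. *)
Definition l_fix (k : fieldType) (lam : k) (V : graded k) (n : nat) (p : int)
  (sh : C_Alg V) (gs : seq (int * C_RBO V)) : C_RBO V :=
  let m := size gs in
  \sum_(sigma : 'S_m)
    let hs := permute sigma in
    let chi := antikoszul k (fun i => (tnth (in_tuple gs) i).1) sigma in
    let e := m%:Z * p
             + \sum_(1 <= i < m) \sum_(0 <= j < i) [seq g.1 | g <- hs]`_j in
    if [seq susp_hom g | g <- hs] is sg1 :: sgs then
      let nested := desusp_hom
        (brace sg1.2 [:: (p + \sum_(g <- sgs) g.1, brace sh sgs)]) in
      if m == n then
        (chi * (-1) ^ e) *:
          (desusp_hom (tcomp sh (sg1 :: sgs)) - (-1 : k) ^ (sg1.1 * p) *: nested)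
      else if (m < n)%N then
        (chi * (-1) ^ (1 + e + p * sg1.1) * lam ^+ (n - m)) *: nested
      else 0
    else 0.

(* Multilinear extension to sh having components of several arities: on a list
   of length u, the component of arity n contributes only if n <= u + m. *)
Definition l_mixed (k : fieldType) (lam : k) (V : graded k) (p : int)
  (sh : C_Alg V) (gs : seq (int * C_RBO V)) : C_RBO V :=
  fun xs => \sum_(n < (size xs + size gs).+1)
              l_fix lam n p (arity n sh) gs xs.

(* The operations l_n, on homogeneous elements given with their degrees. The
   component with values in C_RBO collects, for n > 1, the terms in which the
   j-th argument contributes its C_Alg part and all others their C_RBO part. *)
Definition rba_op (k : fieldType) (lam : k) (V : graded k)
  (xs : seq (int * C_RBA V)) : C_RBA V :=
  ( if xs is [:: x; y] then gerstenhaber (x.1, x.2.1) (y.1, y.2.1) else 0,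
    match xs with
    | [::] => 0
    | [:: x] => desusp_hom (arity 0 x.2.1)
    | _ =>
        \sum_(j < size xs)
          let x := tnth (in_tuple xs) j in
          let gs := [seq (y.1, y.2.2) | y <- take j xs ++ drop j.+1 xs] in
          (-1 : k) ^ (x.1 * (\sum_(y <- take j xs) y.1) + j%:Z) *:
            l_mixed lam x.1 x.2.1 gs
    end ).

Definition has_sum (k : fieldType) (L : lmodType k) (u : nat -> L) (y : L) :
  Prop :=
  exists N : nat, (forall i, (N <= i)%N -> u i = 0) /\ y = \sum_(i < N) u i.

Definition maurer_cartan (k : fieldType) (L : lmodType k)
  (inL : int -> L -> Prop) (ops : seq (int * L) -> L) (alpha : L) : Prop :=
  inL (-1) alpha /\
  has_sum (fun i => let n := i.+1 in
             ((n`!%:R : k)^-1 * (-1) ^+ 'C(n, 2)) *: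
               ops (nseq n (- 1%:Z, alpha))) 0.

(* y is the value of the twisted operation l_n^alpha at xs. *)
Definition twisted_op (k : fieldType) (L : lmodType k)
  (ops : seq (int * L) -> L) (alpha : L) (xs : seq (int * L)) (y : L) : Prop :=
  has_sum (fun i => ((i`!%:R : k)^-1 * (-1) ^+ (i * size xs + 'C(i, 2))) *:
             ops (nseq i (- 1%:Z, alpha) ++ xs)) y.

Definition rota_baxter (k : fieldType) (lam : k) (A : lmodType k)
  (mu : A -> A -> A) (T : A -> A) : Prop :=
  forall a b, mu (T a) (T b) = T (mu a (T b) + mu (T a) b + lam *: mu a b).

(* f represents an element of Hom(A^{(x)n}, A): it is multilinear on lists of
   length n and extended by 0 to all other lists. *)
Definition cochain (k : fieldType) (A : lmodType k) (n : nat)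
  (f : seq A -> A) : Prop :=
  (forall s t : seq A, linear (fun x : A => f (s ++ x :: t))) /\
  (forall s : seq A, size s != n -> f s = 0).

Definition hochschild (k : fieldType) (A : lmodType k)
  (prod lact ract : A -> A -> A) (n : nat) (f : seq A -> A) (a : seq A) : A :=
  if size a == n.+1 then
    (-1 : k) ^+ n.+1 *: lact a`_0 (f (behead a))
    + \sum_(i < n) (-1 : k) ^+ (n - i) *:
        f (take i a ++ prod a`_i a`_i.+1 :: drop i.+2 a)
    + ract (f (take n a)) a`_n
  else 0.

Definition delta (k : fieldType) (A : lmodType k) (mu : A -> A -> A)
  (n : nat) (f : seq A -> A) : seq A -> A := hochschild mu mu mu n f.

Definition partial (k : fieldType) (lam : k) (A : lmodType k)
  (mu : A -> A -> A) (T : A -> A) (n : nat) (f : seq A -> A) : seq A -> A :=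
  hochschild (fun a b => mu a (T b) + mu (T a) b + lam *: mu a b)
    (fun a x => mu (T a) x - T (mu a x))
    (fun x a => mu x (T a) - T (mu x a)) n f.

(* Phi^0 is the identity; for n > 0 the inner sum runs over the sets of indices
   I = {i_1 < ... < i_j} at which T is applied. *)
Definition Phi (k : fieldType) (lam : k) (A : lmodType k) (T : A -> A)
  (n : nat) (f : seq A -> A) (a : seq A) : A :=
  if n == 0%N then f a
  else if size a == n then
    f (map T a)
    - \sum_(j < n) lam ^+ (n - j - 1) *:
        \sum_(I : {set 'I_n} | #|I| == j)
          T (f [seq if i \in I then T a`_i else a`_i | i <- enum 'I_n])
  else 0.

Definition in_coRBA (k : fieldType) (A : lmodType k) (n : nat)
  (x : (seq A -> A) * (seq A -> A)) : Prop :=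
  cochain n x.1 /\ (if n is n'.+1 then cochain n' x.2 else x.2 = 0).

Definition d_coRBA (k : fieldType) (lam : k) (A : lmodType k)
  (mu : A -> A -> A) (T : A -> A) (n : nat)
  (x : (seq A -> A) * (seq A -> A)) : (seq A -> A) * (seq A -> A) :=
  (delta mu n x.1,
   (if n is n'.+1 then - partial lam mu T n' x.2 else 0) - Phi lam T n x.1).

(* A cochain complex regarded as a homological one, degree n being placed in
   degree -n, followed by the shift s, whose differential is -d. *)
Definition homological (M : zmodType) (C : nat -> M -> Prop) (p : int) (x : M) :
  Prop := if - p is Posz n then C n x else x = 0.
Definition homological_diff (M : zmodType) (d : nat -> M -> M) (p : int)
  (x : M) : M := if - p is Posz n then d n x else 0.
Definition shift_complex (M : zmodType) (C : int -> M -> Prop) (p : int) :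
  M -> Prop := C (p - 1).
Definition shift_diff (M : zmodType) (d : int -> M -> M) (p : int) (x : M) : M :=
  - d (p - 1) x.

Definition conc0 (k : fieldType) (A : lmodType k) : graded k :=
  fun d => match d with Posz 0 => A | _ => 'rV[k]_0 : lmodType k end.

Definition incl0 (k : fieldType) (A : lmodType k) (a : A) : gtot (conc0 A) :=
  fun d => match d return conc0 A d with
           | Posz 0 => a
           | _ => (0 : 'rV[k]_0)
           end.

Definition proj0 (k : fieldType) (A : lmodType k) (x : helt (conc0 A)) : A :=
  match x with
  | existT d v => match d return conc0 A d -> A with
                  | Posz 0 => fun a => a
                  | _ => fun _ => 0
                  end v
  end.

(* m = - s o mu o (s^{-1} (x) s^{-1}), where
   (s^{-1} (x) s^{-1})(x (x) y) = (-1)^{|s^{-1}||x|} s^{-1}x (x) s^{-1}y. *)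
Definition mc_mul (k : fieldType) (A : lmodType k) (mu : A -> A -> A) :
  C_Alg (conc0 A) := fun xs =>
  if xs is [:: x; y] then
    - ((-1 : k) ^ (- tag x) *:
       susp (incl0 (mu (proj0 (desusp_elt x)) (proj0 (desusp_elt y)))))
  else 0.

(* tau = T o s^{-1} *)
Definition mc_op (k : fieldType) (A : lmodType k) (T : A -> A) :
  C_RBO (conc0 A) := fun xs =>
  if xs is [:: x] then incl0 (T (proj0 (desusp_elt x))) else 0.

(* s^{(x)n}, which involves no sign on elements of degree 0 *)
Definition susp_seq (k : fieldType) (A : lmodType k) (a : seq A) :
  seq (helt (shift (conc0 A))) :=
  [seq susp_elt (at_deg 0 (incl0 x)) | x <- a].

(* (f, g) |-> (s^{-1} o f o s^{(x)n}, g o s^{(x)n}), simultaneously for all n *)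
Definition identification (k : fieldType) (A : lmodType k)
  (x : C_RBA (conc0 A)) : (seq A -> A) * (seq A -> A) :=
  (fun a => proj0 (at_deg 0 (desusp (x.1 (susp_seq a)))),
   fun a => proj0 (at_deg 0 (x.2 (susp_seq a)))).

(* Main.v *)
From HB Require Import structures.
Require Import Defs.
From mathcomp Require Import all_boot all_order all_fingroup all_algebra ring.
From mathcomp Require Import boolp functions zify.

Set Implicit Arguments.
Unset Strict Implicit.
Unset Printing Implicit Defensive.

Import Order.TTheory GRing.Theory Num.Theory.
Local Open Scope ring_scope.

(** The vector space A sits in degree 0, so sA sits in degree 1, and a map of
degree p out of T^c(sA) has one arity only: 1 - p if it takes values in sA, and
- p if it takes values in A. Such a map vanishes on every list having an entry
of degree other than 1, since those entries are zero; so it is the extension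
([lift_alg], [lift_rbo]) of an ordinary multilinear function f on lists of
vectors, and the identification of the theorem takes the extension back to f.
This gives the bijection of underlying spaces ([in_coRBA_homog], [lift_pairK],
[identificationK]).

Braces and tensor composites of extended maps are extensions of ungraded braces
and composites, in which the Koszul signs count the inputs to the left
([brace_lift], [tcomp_lift]). All brackets of alpha = (m, tau) and x = (f, g)
thereby become expressions in functions on lists, and three identities remain.

- The C_Alg component of the twisted differential only has the term
  - [m, f] of the Gerstenhaber bracket, which is - delta f ([deltaE]).
- In the C_RBO component, the terms whose C_Alg entry is m have, besides m, only
  C_RBO entries: copies of tau and one g. As m is binary there are at most two
  of them. The brackets of m, g and of m, tau, g add up to the differential
  partial g: the first gives the weight-lambda part of the product star, the
  second everything else ([partialE]).
- In the terms whose C_Alg entry is f, of arity n, all C_RBO entries are equal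
  to tau, which has odd degree, so the i! permutations contribute equally and
  cancel the factor 1/i! ([antikoszul_odd], [tau_coef]). The brace of f with
  j copies of tau is the sum over the j-element sets of inputs of f with T
  applied to these inputs ([ubrace_rec_opc]), so the sum over i is Phi f
  ([PhiE], [sum_tau_term]).

The Maurer-Cartan equation uses the same computation with x = alpha: the i-th
term of the one is 1 / (i + 1) times that of the other. The C_Alg
component is then associativity in the form delta mu = 0 ([delta_mulc]), and the
C_RBO component is the Rota-Baxter identity ([rota_baxter_terms]). *)

(** * Inversions and Koszul signs *)

Lemma sign_congr (k : fieldType) (a b c : int) : a = b + 2 * c -> (-1 : k) ^ a = (-1) ^ b.
Proof.
have N1 : (-1 : k) != 0 by rewrite oppr_eq0 oner_eq0.
by move=> ->; rewrite expfzDr // -exprz_exp -exprnP sqrrN expr1n exp1rz mulr1.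
Qed.

Lemma signN1 (k : fieldType) (b : int) (n : nat) : (exists c, b = n%:Z + 2 * c) ->
  (-1 : k) ^ b = (-1) ^+ n.
Proof. by case=> c bE; rewrite (sign_congr k bE) -exprnP. Qed.

Lemma signD (k : fieldType) (b c : int) : (-1 : k) ^ (b + c) = (-1) ^ b * (-1) ^ c.
Proof. by rewrite expfzDr // oppr_eq0 oner_eq0. Qed.

(** Permuting the nodes multiplies a Vandermonde determinant by the signature, and
with the nodes 0, ..., n - 1 the sign of the product formula counts inversions. *)
Lemma prod_inversions n (sigma : 'S_n) :
  \prod_(i < n) \prod_(j < n | (i < j)%N && (sigma j < sigma i)%N) (-1 : int)
  = (-1) ^+ sigma.
Proof.
pose a : 'rV[int]_n := \row_i (i : nat)%:Z.
pose V (b : 'rV[int]_n) := \prod_(i < n) \prod_(j < n | (i < j)%N) (b 0 j - b 0 i).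
have sgV (b : 'rV[int]_n) : (forall i j, i != j -> b 0 i != b 0 j) ->
   Num.sg (V b) = \prod_(i < n) \prod_(j < n | (i < j)%N && (b 0 j < b 0 i)) (-1).
  move=> inj_b; rewrite /V (big_morph _ (@sgrM _) (@sgr1 _)); apply: eq_bigr => i _.
  rewrite (big_morph _ (@sgrM _) (@sgr1 _)) big_mkcondr /=; apply: eq_bigr => j ij.
  have [lt|gt|eq] := ltgtP (b 0 j) (b 0 i).
  - by rewrite ltr0_sg // subr_lt0.
  - by rewrite gtr0_sg // subr_gt0.
  - have: j != i by apply: contraTneq ij => ->; rewrite ltnn.
    by move/inj_b; rewrite eq eqxx.
pose b : 'rV[int]_n := \row_i a 0 (sigma i).
have detb : V b = (-1) ^+ sigma * V a.
  rewrite /V -!det_Vandermonde.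
  have -> : Vandermonde n b = Vandermonde n a *m perm_mx (sigma^-1)%g.
    by rewrite -col_permE; apply/matrixP => i j; rewrite !mxE.
  by rewrite det_mulmx det_perm odd_permV mulrC.
have Va : Num.sg (V a) = 1.
  rewrite sgV; first apply: big1 => i _.
    by apply: big1 => j; rewrite !mxE ltz_nat; case: ltngtP.
  by move=> i j; rewrite !mxE eqz_nat.
have := congr1 Num.sg detb.
rewrite sgrM Va mulr1 sgrX sgrN1 sgV => [|i j].
  move=> <-; apply: eq_bigr => i _; apply: eq_bigl => j.
  by rewrite !mxE ltz_nat.
by rewrite !mxE eqz_nat (inj_eq val_inj) (inj_eq perm_inj).
Qed.

(** For odd elements each inversion contributes -1 to the Koszul sign, which
therefore cancels against the signature. *)
Lemma antikoszul_odd (k : fieldType) n (deg : 'I_n -> int) (sigma : 'S_n) :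
  (forall i, deg i = -1) -> antikoszul k deg sigma = 1.
Proof.
move=> degE; rewrite /antikoszul /koszul.
under eq_bigr => i _ do under eq_bigr => j _ do rewrite !degE mulrNN mulr1 expr1z.
have := congr1 (fun z : int => z%:~R : k) (prod_inversions sigma).
rewrite rmorph_prod rmorphXn rmorphN1 /= => /esym; under eq_bigr => i _.
  rewrite rmorph_prod /=; under eq_bigr => j _ do rewrite rmorphN1.
  over.
by move=> <-; rewrite -expr2 sqrr_sign.
Qed.

Lemma antikoszul1 (k : fieldType) n (deg : 'I_n -> int) : antikoszul k deg 1 = 1.
Proof.
rewrite /antikoszul /koszul odd_perm1 mul1r big1 // => i _.
by rewrite big_pred0 // => j; rewrite !perm1; case: ltngtP.
Qed.

Lemma antikoszul_tperm (k : fieldType) (deg : 'I_2 -> int) :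
  antikoszul k deg (tperm 0 1) = - (-1) ^ (deg 0 * deg 1).
Proof.
rewrite /antikoszul /koszul odd_tperm expr1 mulN1r; congr (- _).
rewrite (bigD1 0) //= [X in _ * X]big1 => [|i i0]; last first.
  by rewrite big_pred0 // => j; case: i i0 => -[|[|]] //= lti; case: j => -[|[|]].
rewrite mulr1 (big_pred1 1) ?tpermL ?tpermR 1?mulrC // => j.
case: j => -[|[|]] // ltj; rewrite (_ : Ordinal ltj = 1) ?tpermL ?tpermR //.
exact: val_inj.
Qed.

Lemma sum_S1 (M : nmodType) (F : 'S_1 -> M) : \sum_s F s = F 1%g.
Proof.
rewrite (bigD1 1%g) //= big1 ?addr0 // => s /eqP[]; apply/permP => i.
by rewrite !ord1.
Qed.

Lemma sum_S2 (M : nmodType) (F : 'S_2 -> M) :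
  \sum_s F s = F 1%g + F (tperm 0 1).
Proof.
rewrite (bigD1 1%g) //= (bigD1 (tperm 0 1)) /=; last first.
  by apply/eqP => /permP/(_ 0); rewrite tpermL perm1.
rewrite big1 ?addr0 // => s /andP[s1 st]; exfalso; move: s1 st.
have [s0|s0] := eqVneq (s 0) 0.
  have s1 : s 1 = 1.
    apply/eqP; have: s 1 != s 0 by rewrite (inj_eq perm_inj).
    by rewrite s0; case: (s 1) => -[|[|]].
  case/eqP; apply/permP=> i; rewrite perm1; case: i => -[|[|]] // lt_i.
    by have -> : Ordinal lt_i = 0 by exact: val_inj.
  by have -> : Ordinal lt_i = 1 by exact: val_inj.
have {s0}s0 : s 0 = 1 by move: s0; case: (s 0) => -[|[|]] // lt_i _; exact: val_inj.
have s1 : s 1 = 0.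
  apply/eqP; have: s 1 != s 0 by rewrite (inj_eq perm_inj).
  by rewrite s0; case: (s 1) => -[|[|]].
move=> _ /eqP[]; apply/permP=> i; case: i => -[|[|]] // lt_i.
  by have -> : Ordinal lt_i = 0 by [exact: val_inj]; rewrite tpermL.
by have -> : Ordinal lt_i = 1 by [exact: val_inj]; rewrite tpermR.
Qed.

(** * Braces of multilinear maps on an ungraded space *)

Section Ungraded.
Variables (k : fieldType) (A : lmodType k).
Implicit Types (f g : seq A -> A) (a xs pre : seq A) (c p q : int).
Implicit Types gs : seq (int * (seq A -> A)).

Definition multilinear f := forall s t, linear (fun x => f (s ++ x :: t)).

(** These functions form Hom(A^{(x)n}, A) with n = 1 - p, the degree of the
corresponding map (sA)^{(x)n} -> sA. Indexing by the degree p covers n < 0 too,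
where only the zero function qualifies. *)
Definition homog p f :=
  multilinear f /\ forall a, (size a)%:Z + p != 1 -> f a = 0.

Fixpoint homogs gs : Prop :=
  if gs is (q, g) :: gs' then homog q g /\ homogs gs' else True.

(** The braces for inputs that all have degree 1, so that the degree of a list of
inputs is its length. *)
Fixpoint ubrace_rec f pre c gs xs : A :=
  match gs with
  | [::] => f (pre ++ xs)
  | (q, g) :: gs' =>
      \sum_(i < (size xs).+1) \sum_(l < (size xs - i).+1)
        (-1 : k) ^ (q * (c + i%:Z)) *:
        ubrace_rec f (pre ++ take i xs ++ [:: g (take l (drop i xs))])
          (c + (i + l)%:Z) gs' (drop (i + l) xs)
  end.

Definition ubrace f gs : seq A -> A := fun xs => ubrace_rec f [::] 0 gs xs.

Fixpoint utcomp_rec f pre c gs xs : A :=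
  match gs with
  | [::] => if nilp xs then f pre else 0
  | (q, g) :: gs' =>
      \sum_(l < (size xs).+1)
        (-1 : k) ^ (q * c) *:
        utcomp_rec f (rcons pre (g (take l xs))) (c + l%:Z) gs' (drop l xs)
  end.

Definition utcomp f gs : seq A -> A := fun xs => utcomp_rec f [::] 0 gs xs.

Lemma multilinear0 f s t : multilinear f -> f (s ++ 0 :: t) = 0.
Proof.
move=> lin_f; have := lin_f s t (-1) 0 0.
by rewrite scaler0 addr0 scaleN1r addNr.
Qed.

Lemma multilinear_mem0 f a : multilinear f -> 0 \in a -> f a = 0.
Proof. by move=> lin_f /splitPr[s t]; exact: multilinear0. Qed.

Lemma multilinearD g s t x y : multilinear g ->
  g (s ++ (x + y) :: t) = g (s ++ x :: t) + g (s ++ y :: t).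
Proof. by move=> lg; have := lg s t 1 x y; rewrite !scale1r. Qed.

Lemma multilinearZ g s t (b : k) x : multilinear g ->
  g (s ++ (b *: x) :: t) = b *: g (s ++ x :: t).
Proof.
by move=> lg; have := lg s t b x 0; rewrite !addr0 multilinear0 // addr0.
Qed.

Lemma fun_addE f g a : (f + g) a = f a + g a. Proof. by []. Qed.
Lemma fun_oppE f a : (- f) a = - f a. Proof. by []. Qed.
Lemma fun_scaleE (b : k) f a : (b *: f) a = b *: f a. Proof. by []. Qed.

Lemma homog0 p : homog p 0.
Proof.
split=> // s t c x y; change (0 = c *: (0 : A) + 0).
by rewrite scaler0 addr0.
Qed.

Lemma homogD p f g : homog p f -> homog p g -> homog p (f + g).
Proof.
move=> [lf df] [lg dg]; split=> [s t c x y|a ha]; rewrite /= !fun_addE.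
  by rewrite lf lg scalerDr addrACA.
by rewrite df // dg // addr0.
Qed.

Lemma homogZ p (b : k) f : homog p f -> homog p (b *: f).
Proof.
move=> [lf df]; split=> [s t c x y|a ha]; rewrite /= !fun_scaleE.
  by rewrite lf scalerDr !scalerA mulrC.
by rewrite df // scaler0.
Qed.

Lemma homogN p f : homog p f -> homog p (- f).
Proof. by rewrite -scaleN1r; exact: homogZ. Qed.

Lemma homogB p f g : homog p f -> homog p g -> homog p (f - g).
Proof. by move=> ? ?; apply: homogD => //; exact: homogN. Qed.

Lemma homog_sum p I (r : seq I) (P : pred I) (F : I -> seq A -> A) :
  (forall i, P i -> homog p (F i)) -> homog p (\sum_(i <- r | P i) F i).
Proof.
move=> hF; elim/big_rec: _ => [|i f Pi]; first exact: homog0.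
by apply: homogD; exact: hF.
Qed.

Lemma homog_cochain n f : cochain n f <-> homog (1 - n%:Z) f.
Proof. by split=> -[lf df]; split=> // a ha; apply: df; lia. Qed.

(** A cut of a list lies either to the right or to the left of a marked entry x,
and which of the two does not depend on x or on what follows it. This locates
the varying entry in proofs that braces and composites are multilinear. *)
Lemma take_drop_cat n (s : seq A) :
  (exists n', forall x t, take n (s ++ x :: t) = s ++ x :: take n' t /\
                          drop n (s ++ x :: t) = drop n' t) \/
  (forall x t, take n (s ++ x :: t) = take n s /\
               drop n (s ++ x :: t) = drop n s ++ x :: t).
Proof.
case: (leqP n (size s)) => [le_ns|lt_sn]; [right|left; exists (n - size s).-1].
  move=> x t; rewrite takel_cat // drop_cat; split=> //.
  by case: ltngtP le_ns => // -> _; rewrite subnn drop_size.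
move=> x t; rewrite take_cat drop_cat ltnNge (ltnW lt_sn) /=.
by rewrite -{1 3}(@prednK (n - size s)) // subn_gt0.
Qed.

(** The two halves are proved together, because an entry that is fed to some g
moves from the remaining inputs to the collected arguments of f. *)
Lemma ubrace_rec_linear f gs (b : k) : multilinear f -> homogs gs ->
  (forall c s x y t xs,
    ubrace_rec f (s ++ (b *: x + y) :: t) c gs xs =
    b *: ubrace_rec f (s ++ x :: t) c gs xs + ubrace_rec f (s ++ y :: t) c gs xs)
  /\ (forall c pre s x y t,
    ubrace_rec f pre c gs (s ++ (b *: x + y) :: t) =
    b *: ubrace_rec f pre c gs (s ++ x :: t) + ubrace_rec f pre c gs (s ++ y :: t)).
Proof.
move=> lf; elim: gs => [_|[q g] gs IH /= [[lg _] /IH[IH1 IH2]]].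
  split=> [c s x y t xs|c pre s x y t] /=.
    by rewrite -!catA !cat_cons lf.
  by rewrite !catA lf.
split=> [c s x y t xs|c pre s x y t].
  rewrite scaler_sumr -big_split; apply: eq_bigr => i _ /=.
  rewrite scaler_sumr -big_split; apply: eq_bigr => l _ /=.
  by rewrite -!catA !cat_cons IH1 scalerDr !scalerA [b * _]mulrC.
rewrite !size_cat /= scaler_sumr -big_split; apply: eq_bigr => i _ /=.
rewrite scaler_sumr -big_split; apply: eq_bigr => l _ /=.
rewrite scalerA [b * _]mulrC -scalerA -scalerDr; congr (_ *: _).
have dropil z : drop (i + l) z = drop l (drop i z) by rewrite drop_drop addnC.
rewrite !dropil.
case: (take_drop_cat i s) => [[i' E]|E].
  rewrite !(proj1 (E _ _)) !(proj2 (E _ _)).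
  set u := take i' t; set v := take l _; set w := drop _ (drop _ t).
  have e z h : pre ++ (s ++ z :: u) ++ h = (pre ++ s) ++ z :: (u ++ h).
    by rewrite -!catA.
  by rewrite !e IH1.
rewrite !(proj1 (E _ _)) !(proj2 (E _ _)).
case: (take_drop_cat l (drop i s)) => [[l' E']|E'].
  (* The varying entry is an input of g, so g is where linearity is used. *)
  rewrite !(proj1 (E' _ _)) !(proj2 (E' _ _)).
  by rewrite lg !catA IH1.
by rewrite !(proj1 (E' _ _)) !(proj2 (E' _ _)) IH2.
Qed.

Lemma ubrace_rec0 f gs pre c xs : multilinear f -> homogs gs ->
  ubrace_rec f (rcons pre 0) c gs xs = 0.
Proof.
move=> lf hgs; have := (ubrace_rec_linear 1 lf hgs).1 c pre 0 0 [::] xs.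
rewrite scaler0 addr0 cats1 scale1r => /eqP.
by rewrite addrC -subr_eq subrr eq_sym => /eqP.
Qed.

(** Each g replaces 1 - q inputs by one, so degrees add. *)
Lemma ubrace_rec_size f p gs pre c xs : homog p f -> homogs gs ->
  (size pre + size xs)%:Z + p + \sum_(g <- gs) g.1 != 1 ->
  ubrace_rec f pre c gs xs = 0.
Proof.
move=> [lf df]; elim: gs pre c xs => [|[q g] gs IH] pre c xs /=.
  by move=> _; rewrite big_nil addr0 -size_cat; exact: df.
move=> [[lg dg] hgs]; rewrite big_cons /= => ne1.
rewrite big1 // => i _; rewrite big1 // => l _.
have [lq|lq] := eqVneq (l%:Z + q) 1; last first.
  rewrite dg; last first.
    by rewrite size_takel // size_drop -ltnS.
  by rewrite catA cats1 ubrace_rec0 // scaler0.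
rewrite IH ?scaler0 //.
rewrite !size_cat /= size_drop size_takel; last by rewrite -ltnS.
move: (ltn_ord i) (ltn_ord l) ne1 lq; lia.
Qed.

Lemma homog_ubrace f p gs : homog p f -> homogs gs ->
  homog (p + \sum_(g <- gs) g.1) (ubrace f gs).
Proof.
move=> hf hgs; split=> [s t b x y|a ha].
  by have [_] := ubrace_rec_linear b (proj1 hf) hgs; exact.
by apply: (ubrace_rec_size _ hf hgs); rewrite add0n -addrA.
Qed.

Lemma utcomp_rec_linear f gs (b : k) : multilinear f -> homogs gs ->
  (forall c s x y t xs,
    utcomp_rec f (s ++ (b *: x + y) :: t) c gs xs =
    b *: utcomp_rec f (s ++ x :: t) c gs xs + utcomp_rec f (s ++ y :: t) c gs xs)
  /\ (forall c pre s x y t,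
    utcomp_rec f pre c gs (s ++ (b *: x + y) :: t) =
    b *: utcomp_rec f pre c gs (s ++ x :: t) + utcomp_rec f pre c gs (s ++ y :: t)).
Proof.
move=> lf; elim: gs => [_|[q g] gs IH /= [[lg _] /IH[IH1 IH2]]].
  split=> [c s x y t xs|c pre s x y t] /=.
    by case: nilp; rewrite ?lf ?scaler0 ?addr0.
  by rewrite /nilp !size_cat /= addnS /= scaler0 addr0.
split=> [c s x y t xs|c pre s x y t].
  rewrite scaler_sumr -big_split; apply: eq_bigr => l _ /=.
  by rewrite !rcons_cat !rcons_cons IH1 scalerDr !scalerA [b * _]mulrC.
rewrite !size_cat /= scaler_sumr -big_split; apply: eq_bigr => l _ /=.
rewrite scalerA [b * _]mulrC -scalerA -scalerDr; congr (_ *: _).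
case: (take_drop_cat l s) => [[l' E]|E].
  rewrite !(proj1 (E _ _)) !(proj2 (E _ _)).
  by rewrite lg -!cats1 IH1.
by rewrite !(proj1 (E _ _)) !(proj2 (E _ _)) IH2.
Qed.

Lemma utcomp_rec0 f gs pre c xs : multilinear f -> homogs gs ->
  utcomp_rec f (rcons pre 0) c gs xs = 0.
Proof.
move=> lf hgs; have := (utcomp_rec_linear 1 lf hgs).1 c pre 0 0 [::] xs.
rewrite scaler0 addr0 cats1 scale1r => /eqP.
by rewrite addrC -subr_eq subrr eq_sym => /eqP.
Qed.

Lemma utcomp_rec_size f p gs pre c xs : homog p f -> homogs gs ->
  (size pre + size xs)%:Z + p + \sum_(g <- gs) g.1 != 1 ->
  utcomp_rec f pre c gs xs = 0.
Proof.
move=> [lf df]; elim: gs pre c xs => [|[q g] gs IH] pre c xs /=.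
  by move=> _; rewrite big_nil addr0; case: xs => //=; rewrite addn0; exact: df.
move=> [[lg dg] hgs]; rewrite big_cons /= => ne1.
rewrite big1 // => l _.
have [lq|lq] := eqVneq (l%:Z + q) 1; last first.
  rewrite dg; last first.
    by rewrite size_takel // -ltnS.
  by rewrite utcomp_rec0 // scaler0.
rewrite IH ?scaler0 //.
rewrite size_rcons size_drop.
move: (ltn_ord l) ne1 lq; set S := \sum_(g0 <- gs) _.
move: S (nat_of_ord l) => S l0; lia.
Qed.

Lemma homog_utcomp f p gs : homog p f -> homogs gs ->
  homog (p + \sum_(g <- gs) g.1) (utcomp f gs).
Proof.
move=> hf hgs; split=> [s t b x y|a ha].
  by have [_] := utcomp_rec_linear b (proj1 hf) hgs; exact.
by apply: (utcomp_rec_size _ hf hgs); rewrite add0n -addrA.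
Qed.

Lemma utcomp_rec_cons f pre c q g gs xs :
  utcomp_rec f pre c ((q, g) :: gs) xs = \sum_(l < (size xs).+1)
    (-1 : k) ^ (q * c) *:
      utcomp_rec f (rcons pre (g (take l xs))) (c + l%:Z) gs (drop l xs).
Proof. by []. Qed.

Lemma utcomp_rec_last f pre c q g xs :
  utcomp_rec f pre c [:: (q, g)] xs =
    (-1 : k) ^ (q * c) *: f (rcons pre (g xs)).
Proof.
rewrite utcomp_rec_cons big_ord_recr big1 => [|i _] /=.
  by rewrite add0r drop_size take_size.
by rewrite /nilp size_drop subn_eq0 leqNgt ltn_ord scaler0.
Qed.

Lemma ubrace_zero gs : ubrace (0 : seq A -> A) gs = 0.
Proof.
apply/funext => xs; rewrite /ubrace; move: [::] (0 : int) => pre c.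
elim: gs pre c xs => [|[q g] gs IH] pre c xs //=.
by rewrite big1 // => i _; rewrite big1 // => l _; rewrite IH scaler0.
Qed.

Lemma ubrace_arg0 f q : multilinear f -> ubrace f [:: (q, 0)] = 0.
Proof.
move=> lf; apply/funext => a; rewrite /ubrace /= big1 // => i _.
by rewrite big1 // => l _; rewrite -catA (multilinear0 _ _ lf) scaler0.
Qed.

Lemma utcomp_arg0l f q gs : multilinear f -> homogs gs ->
  utcomp f ((q, 0) :: gs) = 0.
Proof.
move=> lf hgs; apply/funext => a; rewrite /utcomp /= big1 // => l _.
by rewrite (utcomp_rec0 [::] _ _ lf hgs) scaler0.
Qed.

Lemma utcomp_arg0r f r h q : multilinear f -> utcomp f [:: (r, h); (q, 0)] = 0.
Proof.
move=> lf; apply/funext => a; rewrite /utcomp utcomp_rec_cons big1 // => l _.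
rewrite utcomp_rec_last -cats1 (multilinear0 _ _ lf).
by rewrite !scaler0.
Qed.

(** Only the blocks of length l survive: on the others g vanishes. *)
Lemma ubrace1 f q g l a : multilinear f -> homog q g -> q = 1 - l%:Z ->
  (l <= size a)%N ->
  ubrace f [:: (q, g)] a = \sum_(i < (size a - l).+1)
    (-1 : k) ^ (q * i%:Z) *:
      f (take i a ++ g (take l (drop i a)) :: drop (i + l) a).
Proof.
move=> lf [lg dg] ql la; rewrite /ubrace /=.
have le_r : ((size a - l).+1 <= (size a).+1)%N by rewrite ltnS leq_subr.
rewrite (big_ord_widen _ (fun i => (-1 : k) ^ (q * i%:Z) *:
      f (take i a ++ g (take l (drop i a)) :: drop (i + l) a)) le_r).
rewrite [RHS]big_mkcond; apply: eq_bigr => i _ /=.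
have zero j : (j <= size a - i)%N -> j != l ->
   f ((take i a ++ [:: g (take j (drop i a))]) ++ drop (i + j) a) = 0.
  move=> le_j ne_jl; rewrite dg; last by rewrite size_takel ?size_drop //; lia.
  by rewrite -catA multilinear0.
rewrite ltnS; case: ifP => [le_i|gt_i].
  have lt_l : (l < (size a - i).+1)%N by move: (ltn_ord i); lia.
  rewrite (bigD1 (Ordinal lt_l)) //= big1 => [|j ne_j].
    by rewrite addr0 add0r -catA.
  by rewrite zero ?scaler0 // -ltnS.
rewrite big1 // => j _; rewrite zero ?scaler0 -1?ltnS //.
by move: (ltn_ord i) (ltn_ord j) gt_i la; lia.
Qed.

Lemma ubrace1_small f q g l a : multilinear f -> homog q g -> q = 1 - l%:Z ->
  (size a < l)%N -> ubrace f [:: (q, g)] a = 0.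
Proof.
move=> lf [lg dg] ql la; rewrite /ubrace /=.
rewrite big1 // => i _; rewrite big1 // => j _; rewrite dg.
  by rewrite -catA multilinear0 ?scaler0.
by rewrite size_takel ?size_drop -1?ltnS //; move: (ltn_ord j); lia.
Qed.

Lemma ubrace_bin g h a N : multilinear g -> homog (-1) h -> size a = N.+1 ->
  ubrace g [:: (-1, h)] a = \sum_(i < N) (-1 : k) ^ (- i%:Z) *:
     g (take i a ++ h [:: a`_i; a`_i.+1] :: drop i.+2 a).
Proof.
move=> lg hh sa; case: N sa => [|N] sa.
  by rewrite (ubrace1_small (l := 2)) ?big_ord0 // sa.
rewrite (ubrace1 (l := 2)) ?sa // subSS subn1 /=; apply: eq_bigr => i _.
rewrite mulN1r addn2 (drop_nth 0) ?(drop_nth 0 (_ : i.+1 < size a)%N) ?sa //=.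
- by rewrite take0.
- by move: (ltn_ord i); lia.
- by rewrite ltnS ltnW.
Qed.

Section RotaBaxterPieces.
Variables (mu : {bilinear A -> A -> A}) (T : {linear A -> A}).

(** The function of which tau is the extension; [mulc] plays this part for m. *)
Definition opc a : A := if a is [:: x] then T x else 0.
Definition mulc a : A := if a is [:: x; y] then mu x y else 0.

Lemma homog_opc : homog 0 opc.
Proof.
split=> [s t b x y|[|x [|y a]] //]; case: s => [|u [|v s]]; case: t => [|w t] /=;
  rewrite ?linearP ?scaler0 ?addr0 //.
Qed.

Lemma homogs_nseq_opc n : homogs (nseq n (0, opc)).
Proof. by elim: n => //= n IH; split=> //; exact: homog_opc. Qed.

Lemma homog_mulc : homog (-1) mulc.
Proof.
split=> [s t b x y|[|x [|y [|z a]]] //].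
case: s => [|u [|v [|v' s]]]; case: t => [|w [|w' t]] /=;
  rewrite ?linearPl ?linearPr ?scaler0 ?addr0 //.
Qed.

(** Since opc has one input, h must consume all the inputs. *)
Lemma ubrace_opc q h a : ubrace opc [:: (q, h)] a = T (h a).
Proof.
rewrite /ubrace /= big_ord_recl [X in _ + X]big1 => [|i _]; last first.
  rewrite big1 // => l _; case: a i l => [|x a] [i lti] l //=.
  by case: take => [|? ?] /=; rewrite ?scaler0.
rewrite addr0 subn0 big_ord_recr big1 => [|l _] /=.
  by rewrite take0 drop0 take_size drop_size /= mulr0 expr0z scale1r add0r.
rewrite take0 /= add0n drop0.
case E: (drop l a) => [|x s] /=; last by rewrite scaler0.
by move/(congr1 size): E; rewrite size_drop /=; move: (ltn_ord l); lia.
Qed.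

Lemma utcomp_rec_opc f pre c n xs : multilinear f ->
  utcomp_rec f pre c (nseq n (0, opc)) xs =
  if size xs == n then f (pre ++ map T xs) else 0.
Proof.
move=> lf; have hs := homogs_nseq_opc.
elim: n pre c xs => [|n IH] pre c xs /=.
  by case: xs => //=; rewrite cats0.
case: xs => [|x xs] /=.
  by rewrite big_ord1 /= utcomp_rec0 ?scaler0.
rewrite big_ord_recl /= utcomp_rec0 // scaler0 add0r big_ord_recl /= take0 drop0.
rewrite mul0r expr0z scale1r IH big1 => [|i _] /=; first by rewrite cat_rcons eqSS addr0.
case: xs i => [|y xs] [i lti] //=.
by rewrite utcomp_rec0 ?scaler0.
Qed.

Lemma utcomp_opc f n a : multilinear f ->
  utcomp f (nseq n (0, opc)) a = if size a == n then f (map T a) else 0.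
Proof. exact: utcomp_rec_opc. Qed.

Lemma utcomp_mulc_opl q g x a : homog q g ->
  utcomp mulc [:: (0, opc); (q, g)] (x :: a) = (-1) ^ q *: mu (T x) (g a).
Proof.
move=> hg; have hs : homogs [:: (q, g)] by [].
have lm := homog_mulc.1.
rewrite /utcomp utcomp_rec_cons big_ord_recl utcomp_rec0 // scaler0 add0r.
rewrite big_ord_recl big1 ?addr0 => [|i _].
  by rewrite utcomp_rec_last mul0r expr0z scale1r /= take0 drop0 add0r mulr1.
by case: a i => [|y a] [i lti] //; rewrite utcomp_rec0 ?scaler0.
Qed.

Lemma utcomp_mulc_opr q g a x :
  utcomp mulc [:: (q, g); (0, opc)] (rcons a x) = mu (g a) (T x).
Proof.
have key pre c xs : utcomp_rec mulc pre c [:: (0, opc)] xs =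
    if size xs == 1 then mulc (pre ++ map T xs) else 0.
  by rewrite -(utcomp_rec_opc _ c 1 _ homog_mulc.1).
rewrite /utcomp utcomp_rec_cons size_rcons; under eq_bigr do rewrite key.
rewrite !big_ord_recr big1 => [|i _] /=.
  rewrite add0r [drop _.+1 _]drop_oversize ?size_rcons //= drop_rcons // drop_size.
  by rewrite /= -cats1 take_size_cat // mulr0 scaler0 expr0z scale1r addr0.
rewrite size_drop size_rcons; case: eqP => [|_]; last by rewrite scaler0.
by move: (ltn_ord i); lia.
Qed.

Lemma ubrace_mulc q g l a : homog q g -> q = 1 - l%:Z -> size a = l.+1 ->
  ubrace mulc [:: (q, g)] a =
    mu (g (take l a)) a`_l + (-1) ^ q *: mu a`_0 (g (behead a)).
Proof.
move=> hg ql sa; rewrite (ubrace1 homog_mulc.1 hg ql) ?sa //.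
rewrite subSnn 2!big_ord_recl big_ord0 addr0 mulr0 mulr1 expr0z scale1r.
rewrite take0 drop0 add0n (@drop_oversize _ (lift ord0 ord0 + l)) ?sa //.
case: a sa => //= x a [<-]; rewrite drop0 take0 take_size; congr (_ + _).
by rewrite (drop_nth 0) // drop_oversize.
Qed.

End RotaBaxterPieces.
End Ungraded.

(** * Inserting an operator into a multilinear map *)

(** The subset of 'I_n.+1 whose trace on the successors is J and that contains 0
exactly when b holds: a recursion on subsets parallel to recursion on lists. *)
Definition cons_set n (b : bool) (J : {set 'I_n}) : {set 'I_n.+1} :=
  [set i | if unlift ord0 i is Some j then j \in J else b].

Lemma cons_set0 n b (J : {set 'I_n}) : (ord0 \in cons_set b J) = b.
Proof. by rewrite inE unlift_none. Qed.

Lemma cons_setS n b (J : {set 'I_n}) j : (lift ord0 j \in cons_set b J) = (j \in J).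
Proof. by rewrite inE liftK. Qed.

Lemma card_cons_set n b (J : {set 'I_n}) : #|cons_set b J| = (b + #|J|)%N.
Proof.
rewrite -!sum1_card big_mkcond big_ord_recl cons_set0 [in RHS]big_mkcond /=.
congr addn.
by apply: eq_bigr => i _; rewrite cons_setS.
Qed.

Lemma sum_cons_set (M : nmodType) n (F : {set 'I_n.+1} -> M) :
  \sum_I F I = \sum_J F (cons_set true J) + \sum_J F (cons_set false J).
Proof.
rewrite (reindex (fun bJ : bool * {set 'I_n} => cons_set bJ.1 bJ.2)); last first.
  exists (fun I : {set 'I_n.+1} => (ord0 \in I, [set j | lift ord0 j \in I]))
      => [[b J]|I] _ /=.
    rewrite cons_set0; congr pair; apply/setP => j; by rewrite inE cons_setS.
  apply/setP => i; case: (unliftP ord0 i) => [j|] ->; last by rewrite cons_set0.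
  by rewrite cons_setS inE.
rewrite -(pair_bigA _ (fun b J => F (cons_set b J))) /=.
by rewrite big_bool.
Qed.

Section Powers.
Variables (k : fieldType) (A : lmodType k) (T : {linear A -> A}).
Implicit Types (f : seq A -> A) (xs pre : seq A).

Definition apply_on n (I : {set 'I_n}) xs :=
  [seq if i \in I then T xs`_i else xs`_i | i : 'I_n <- enum 'I_n].

Lemma apply_on_cons n b (J : {set 'I_n}) x xs :
  apply_on (cons_set b J) (x :: xs) = (if b then T x else x) :: apply_on J xs.
Proof.
rewrite /apply_on enum_ordSl /= cons_set0; congr cons.
by rewrite -map_comp; apply: eq_map => i; rewrite /= cons_setS.
Qed.

Lemma ubrace_rec_opcS f pre c j xs : multilinear f ->
  ubrace_rec f pre c (nseq j.+1 (0, opc T)) xs =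
  \sum_(i < size xs) ubrace_rec f (pre ++ rcons (take i xs) (T xs`_i))
                       (c + i.+1%:Z) (nseq j (0, opc T)) (drop i.+1 xs).
Proof.
move=> lf; have hs := homogs_nseq_opc T.
rewrite /= big_ord_recr /= subnn big_ord1 drop_size catA cats1 ubrace_rec0 //.
rewrite scaler0 addr0; apply: eq_bigr => i _.
have lti := ltn_ord i.
have lt1 : (1 < (size xs - i).+1)%N by lia.
rewrite (bigD1 (Ordinal lt1)) //= big1 => [|l ne_l].
  rewrite mul0r expr0z scale1r addr0 addn1 (drop_nth 0) //= take0.
  by rewrite cats1.
rewrite (_ : opc _ _ = 0) ?catA ?cats1 ?ubrace_rec0 ?scaler0 //.
have: size (take l (drop i xs)) = l by rewrite size_takel // size_drop -ltnS.
case: take ne_l => [|y [|z s]] //= ne_l el.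
by case/eqP: ne_l; exact: val_inj.
Qed.

(** By induction on xs: the first input either receives the first copy of T or is
passed to f unchanged, according as the set contains 0 or not. *)
Lemma ubrace_rec_opc f pre c j xs : multilinear f ->
  ubrace_rec f pre c (nseq j (0, opc T)) xs =
  \sum_(I : {set 'I_(size xs)} | #|I| == j) f (pre ++ apply_on I xs).
Proof.
move=> lf; elim: xs pre c j => [|x xs IH] pre c [|j].
- rewrite (big_pred1 set0) => [|I]; last by rewrite cards_eq0.
  by rewrite /apply_on (_ : enum _ = [::]) //; apply: size0nil; rewrite size_enum_ord.
- rewrite ubrace_rec_opcS // big_ord0 big_pred0 // => I.
  by apply/negbTE; have := max_card (mem I); rewrite card_ord; case: #|_|.
- rewrite (big_pred1 set0) => [|I]; last by rewrite cards_eq0.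
  rewrite /= /apply_on; congr (f (_ ++ _)).
  rewrite -[LHS](mkseq_nth 0) /mkseq -val_enum_ord -map_comp.
  by apply: eq_map => i; rewrite inE.
rewrite ubrace_rec_opcS // big_ord_recl [in RHS]big_mkcond [RHS]sum_cons_set.
congr (_ + _).
  rewrite /= drop0 IH [LHS]big_mkcond /=; apply: eq_bigr => J _.
  by rewrite card_cons_set apply_on_cons /= add1n eqSS -catA.
(* Position i.+1 in x :: xs is position i in xs once x has been collected. *)
transitivity (ubrace_rec f (rcons pre x) (c + 1) (nseq j.+1 (0, opc T)) xs).
  rewrite ubrace_rec_opcS //; apply: eq_bigr => i _.
  by rewrite cat_rcons /= -addrA.
rewrite IH [LHS]big_mkcond /=; apply: eq_bigr => J _.
by rewrite card_cons_set apply_on_cons /= add0n cat_rcons.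
Qed.
End Powers.

(** * Graded maps out of a space in degree zero *)

Section Transfer.
Variables (k : fieldType) (A : lmodType k).
Local Notation V := (conc0 A).
Local Notation U := (shift (conc0 A)).
Implicit Types (f g : seq A -> A) (a : seq A) (xs pre : seq (helt U)).

Definition elt (x : A) : helt U := @Tagged int 1 U (x : U 1).
(** The vector of A underlying an element of sA; it is 0 off degree 1. *)
Definition proj (x : helt U) : A := proj0 (desusp_elt x).
Definition in_deg1 xs := all (fun x => tag x == 1) xs.
Definition lift_alg f : C_Alg V := fun xs => susp (incl0 (f (map proj xs))).
Definition lift_rbo f : C_RBO V := fun xs => incl0 (f (map proj xs)).

Lemma gtotP (W : graded k) (u v : gtot W) : (forall e, u e = v e) -> u = v.
Proof. exact: functional_extensionality_dep. Qed.

Lemma conc0_neq0 (e : int) (v : V e) : e != 0 -> v = 0.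
Proof. by case: e v => [[|n]|n] v // _; exact: thinmx0. Qed.

Lemma conc0_ext (u v : gtot V) : (u 0 : A) = v 0 -> u = v.
Proof.
move=> uv; apply: gtotP => e; have [->|e0] := eqVneq e 0; first exact: uv.
by rewrite (conc0_neq0 (u e) e0) (conc0_neq0 (v e) e0).
Qed.

Lemma shift_conc0_ext (u v : gtot U) : (u 1 : A) = v 1 -> u = v.
Proof.
move=> uv; apply: gtotP => e; have [->|e0] := eqVneq e 1; first exact: uv.
have e1 : e - 1 != 0 by rewrite subr_eq0.
by rewrite (conc0_neq0 (u e : V (e - 1)) e1) (conc0_neq0 (v e : V (e - 1)) e1).
Qed.

Lemma susp_eltE (x : A) : susp_elt (at_deg 0 (incl0 x)) = elt x.
Proof.
rewrite /susp_elt /elt /=.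
have key (e : 0 = 0 :> int) : ecast d (V d) e x = x by rewrite eq_axiomK.
exact: (congr1 (fun y : A => @Tagged int 1 U (y : U 1)) (key _)).
Qed.

Lemma susp_seqE a : susp_seq a = map elt a.
Proof. by apply: eq_map => x; exact: susp_eltE. Qed.

Lemma desuspK (v : gtot V) : desusp (susp v) = v.
Proof.
apply: gtotP => e; rewrite /desusp /susp.
have cast d d' (E : d = d') : ecast x (V x) E (v d) = v d' by case: d' / E.
exact: cast.
Qed.

Lemma deg1_eltE (x : helt U) : tag x = 1 -> x = elt (proj x).
Proof. by case: x => d v /= d1; case: _ / (esym d1) in v *. Qed.

Lemma off_deg1_eq0 (x : helt U) : tag x != 1 -> tagged x = 0.
Proof.
by case: x => d v /= d1; apply: (conc0_neq0 (v : V (d - 1))); rewrite subr_eq0.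
Qed.

Lemma proj_linear d : linear (fun v : U d => proj (Tagged U v)).
Proof.
rewrite /proj /desusp_elt /= /U => c u v /=.
move: u v; rewrite /shift; case: (d - 1) => [[|n]|n] u v //=; by rewrite scaler0 addr0.
Qed.

Lemma proj_off_deg1 (x : helt U) : tag x != 1 -> proj x = 0.
Proof.
case: x => d v /= d1; rewrite /proj /desusp_elt /=.
have: d - 1 != 0 by rewrite subr_eq0.
by move: v; rewrite /shift; case: (d - 1) => [[|n]|n].
Qed.

Lemma in_deg1_eltsK xs : in_deg1 xs -> xs = map elt (map proj xs).
Proof. by elim: xs => //= x xs IH /andP[/eqP gx gxs]; rewrite -IH // -deg1_eltE. Qed.

Lemma in_deg1_elts a : in_deg1 (map elt a).
Proof. by apply/allP => x /mapP[y _ ->]. Qed.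

Lemma proj_elts a : map proj (map elt a) = a.
Proof. by rewrite -map_comp map_id_in. Qed.

Lemma tdeg_in_deg1 xs : in_deg1 xs -> tdeg xs = size xs.
Proof.
rewrite /tdeg; elim: xs => [|x xs IH] /=; first by rewrite big_nil.
by case/andP=> /eqP gx gxs; rewrite big_cons IH // gx.
Qed.

(** Multilinear functions thus vanish on the underlying vectors, so the lists with
an entry off degree 1 never contribute. *)
Lemma off_deg1_mem0 xs : ~~ in_deg1 xs -> 0 \in map proj xs.
Proof. by case/allPn=> x xin bx; apply/mapP; exists x => //; rewrite proj_off_deg1. Qed.

Lemma proj_at_deg d x : proj (at_deg d (susp (incl0 x))) = if d == 1 then x else 0.
Proof.
rewrite /proj /desusp_elt /at_deg /susp /= -(subr_eq0 d).
by case: (d - 1) => [[|n]|n].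
Qed.

(** The degree recorded by [hval] is 1 except on lists where g vanishes anyway. *)
Lemma proj_hval q g xs : homog q g -> proj (hval q (lift_alg g) xs) = g (map proj xs).
Proof.
move=> [lg dg]; rewrite /hval /lift_alg proj_at_deg.
case: (boolP (in_deg1 xs)) => [gxs|bxs].
  rewrite tdeg_in_deg1 //; case: eqP => // /eqP ne1.
  by rewrite dg // size_map addrC.
by rewrite (multilinear_mem0 lg (off_deg1_mem0 bxs)) if_same.
Qed.

Lemma incl0_linear : linear (@incl0 k A).
Proof. by move=> c x y; apply: conc0_ext. Qed.
HB.instance Definition _ :=
  GRing.isLinear.Build k A (gtot V) _ (@incl0 k A) incl0_linear.

Lemma susp_linear (W : graded k) : linear (@susp k W).
Proof. by []. Qed.
HB.instance Definition _ (W : graded k) :=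
  GRing.isLinear.Build k (gtot W) (gtot (shift W)) _ (@susp k W) (@susp_linear W).

Lemma lift_alg_linear : linear lift_alg.
Proof. by move=> c f g; apply/funext => xs; rewrite /lift_alg !linearP. Qed.
HB.instance Definition _ :=
  GRing.isLinear.Build k (seq A -> A) (C_Alg V) _ lift_alg lift_alg_linear.
Lemma lift_rbo_linear : linear lift_rbo.
Proof. by move=> c f g; apply/funext => xs; rewrite /lift_rbo !linearP. Qed.
HB.instance Definition _ :=
  GRing.isLinear.Build k (seq A -> A) (C_RBO V) _ lift_rbo lift_rbo_linear.

Lemma desusp_lift_alg f : desusp_hom (lift_alg f) = lift_rbo f.
Proof. by apply/funext => xs; exact: desuspK. Qed.

Lemma arity_lift_alg n f : arity n (lift_alg f) =
  lift_alg (fun a => if size a == n then f a else 0).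
Proof.
apply/funext => xs; rewrite /arity /lift_alg size_map; case: ifP => // _.
by rewrite !linear0.
Qed.

Definition tag_alg (g : int * (seq A -> A)) : int * C_Alg V := (g.1, lift_alg g.2).

Lemma brace_rec_off_deg1 f pre c gs xs : multilinear f -> homogs gs ->
  0 \in map proj (pre ++ xs) ->
  brace_rec (lift_alg f) pre c (map tag_alg gs) xs = 0.
Proof.
move=> lf; elim: gs pre c xs => [|[q g] gs IH] pre c xs /=.
  by move=> _ in0; rewrite /lift_alg (multilinear_mem0 lf in0) !linear0.
case=> hg hgs in0; rewrite big1 // => i _; rewrite big1 // => l _.
rewrite IH ?scaler0 // !map_cat /= proj_hval // !mem_cat !inE.
move: in0; rewrite -{1}(cat_take_drop i xs) -{1}(cat_take_drop l (drop i xs)).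
rewrite drop_drop addnC !map_cat !mem_cat.
case/or4P=> [->|->|in0|->]; rewrite ?orbT //.
by rewrite (multilinear_mem0 hg.1 in0) eqxx ?orbT.
Qed.

(** On lists of elements of degree 1 the two recursions agree term by term, the
degree of a prefix being its length. *)
Lemma brace_rec_lift f pre c gs xs : homogs gs -> in_deg1 xs ->
  brace_rec (lift_alg f) pre c (map tag_alg gs) xs =
  susp (incl0 (ubrace_rec f (map proj pre) c gs (map proj xs))).
Proof.
move=> hgs; elim: gs pre c xs hgs => [|[q g] gs IH] pre c xs /=.
  by move=> _ _; rewrite /lift_alg map_cat.
case=> hg hgs gxs; rewrite !linear_sum size_map; apply: eq_bigr => i _.
rewrite !linear_sum; apply: eq_bigr => l _ /=.
have /andP[gt gd]: in_deg1 (take i xs) && in_deg1 (drop i xs).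
  by rewrite -all_cat cat_take_drop.
have /andP[gt' gd']: in_deg1 (take (i + l) xs) && in_deg1 (drop (i + l) xs).
  by rewrite -all_cat cat_take_drop.
rewrite !linearZ; congr (_ *: _).
  by rewrite tdeg_in_deg1 // size_takel // -ltnS.
rewrite IH // !map_cat /= proj_hval // !map_take !map_drop tdeg_in_deg1 //.
by rewrite size_takel //; move: (ltn_ord i) (ltn_ord l); lia.
Qed.

(** Both sides vanish on lists with an entry off degree 1. *)
Lemma brace_lift f gs : multilinear f -> homogs gs ->
  brace (lift_alg f) (map tag_alg gs) = lift_alg (ubrace f gs).
Proof.
move=> lf hgs; apply/funext => xs; rewrite /brace.
have [gxs|bxs] := boolP (in_deg1 xs); first by rewrite brace_rec_lift.
have in0 := off_deg1_mem0 bxs; rewrite brace_rec_off_deg1 // /lift_alg.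
have lu : multilinear (ubrace f gs).
  by move=> s t b x y; have [_] := ubrace_rec_linear b lf hgs; exact.
by rewrite (multilinear_mem0 lu) // !linear0.
Qed.

Lemma tcomp_rec_off_deg1 f pre c gs xs : multilinear f -> homogs gs ->
  0 \in map proj (pre ++ xs) ->
  tcomp_rec (lift_alg f) pre c (map tag_alg gs) xs = 0.
Proof.
move=> lf; elim: gs pre c xs => [|[q g] gs IH] pre c xs /=.
  move=> _; case: xs => //= in0; rewrite cats0 in in0.
  by rewrite /lift_alg (multilinear_mem0 lf in0) !linear0.
case=> hg hgs in0; rewrite big1 // => l _.
rewrite IH ?scaler0 // map_cat map_rcons /= proj_hval // mem_cat mem_rcons !inE.
move: in0; rewrite -{1}(cat_take_drop l xs) !map_cat !mem_cat.
case/or3P=> [->|in0|->]; rewrite ?orbT //.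
by rewrite (multilinear_mem0 hg.1 in0) eqxx ?orbT.
Qed.

Lemma tcomp_rec_lift f pre c gs xs : homogs gs -> in_deg1 xs ->
  tcomp_rec (lift_alg f) pre c (map tag_alg gs) xs =
  susp (incl0 (utcomp_rec f (map proj pre) c gs (map proj xs))).
Proof.
move=> hgs; elim: gs pre c xs hgs => [|[q g] gs IH] pre c xs /=.
  by move=> _ _; case: xs => //=; rewrite !linear0.
case=> hg hgs gxs; rewrite !linear_sum size_map; apply: eq_bigr => l _ /=.
have /andP[gt gd]: in_deg1 (take l xs) && in_deg1 (drop l xs).
  by rewrite -all_cat cat_take_drop.
rewrite !linearZ; congr (_ *: _).
rewrite IH // map_rcons /= proj_hval // !map_take !map_drop tdeg_in_deg1 //.
by rewrite size_takel // -ltnS.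
Qed.

Lemma tcomp_lift f gs : multilinear f -> homogs gs ->
  tcomp (lift_alg f) (map tag_alg gs) = lift_alg (utcomp f gs).
Proof.
move=> lf hgs; apply/funext => xs; rewrite /tcomp.
have [gxs|bxs] := boolP (in_deg1 xs); first by rewrite tcomp_rec_lift.
have in0 := off_deg1_mem0 bxs; rewrite tcomp_rec_off_deg1 // /lift_alg.
have lu : multilinear (utcomp f gs).
  by move=> s t b x y; have [_] := utcomp_rec_linear b lf hgs; exact.
by rewrite (multilinear_mem0 lu) // !linear0.
Qed.

Lemma elt_linear_eval (W : graded k) p (F : homT U W) e s t : is_hom p F ->
  linear (fun x : A => F (map elt s ++ elt x :: map elt t) e).
Proof. by move=> [lF _] c x y; exact: (lF _ _ 1 e c x y). Qed.

(** An entry off degree 1 is zero, and so is its replacement. *)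
Lemma is_hom_elts (W : graded k) p (F : homT U W) xs : is_hom p F ->
  F xs = F (map elt (map proj xs)).
Proof.
move=> hF; have [gxs|bxs] := boolP (in_deg1 xs); first by rewrite -in_deg1_eltsK.
apply: gtotP => e.
case/splitPr: (off_deg1_mem0 bxs) => s' t'.
rewrite map_cat /=; have := elt_linear_eval e s' t' hF (-1) 0 0.
rewrite scaler0 addr0 scaleN1r addNr => ->.
case/allPn: bxs => x /splitPr[s t] bx; case: x bx => d v bx.
have v0 : v = 0 by exact: (off_deg1_eq0 bx).
have := hF.1 s t d e (-1) 0 0.
by rewrite v0 scaler0 addr0 scaleN1r addNr.
Qed.

Lemma tdeg_elts a : tdeg (map elt a) = size a.
Proof. by rewrite tdeg_in_deg1 ?in_deg1_elts // size_map. Qed.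

Lemma is_hom_lift_alg p f : homog p f -> is_hom p (lift_alg f).
Proof.
move=> [lf df]; split=> [xs ys d e c x y|xs e ne].
  rewrite /lift_alg !map_cat /=.
  rewrite -/(proj (Tagged U (c *: x + y))) proj_linear lf !linearP //.
rewrite /lift_alg /susp; have [gxs|bxs] := boolP (in_deg1 xs); last first.
  by rewrite (multilinear_mem0 lf (off_deg1_mem0 bxs)) linear0.
have [e1|ne1] := eqVneq e 1; last by apply: conc0_neq0; rewrite subr_eq0.
rewrite df ?linear0 // size_map.
by move: ne; rewrite e1 tdeg_in_deg1 // eq_sym addrC.
Qed.

Lemma is_hom_lift_rbo p f : homog (p + 1) f -> is_hom p (lift_rbo f).
Proof.
move=> [lf df]; split=> [xs ys d e c x y|xs e ne].
  rewrite /lift_rbo !map_cat /=.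
  rewrite -/(proj (Tagged U (c *: x + y))) proj_linear lf !linearP //.
rewrite /lift_rbo; have [gxs|bxs] := boolP (in_deg1 xs); last first.
  by rewrite (multilinear_mem0 lf (off_deg1_mem0 bxs)) linear0.
have [e1|ne1] := eqVneq e 0; last exact: conc0_neq0.
rewrite df ?linear0 // size_map.
by move: ne; rewrite e1 tdeg_in_deg1 //; lia.
Qed.

(** The C_Alg and C_RBO halves of the identification, read off in the only degree
where sA, respectively A, is nonzero. *)
Definition unlift_alg (F : C_Alg V) : seq A -> A := fun a => F (map elt a) 1.
Definition unlift_rbo (F : C_RBO V) : seq A -> A := fun a => F (map elt a) 0.

Lemma identificationE (x : C_RBA V) : identification x = (unlift_alg x.1, unlift_rbo x.2).
Proof.
congr pair; apply/funext => a; rewrite susp_seqE //.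
rewrite /unlift_alg /at_deg /desusp /=.
have key (e : 0 = 0 :> int) (y : A) : ecast d (V d) e y = y by rewrite eq_axiomK.
exact: (key (addrK 1 0)).
Qed.

Lemma lift_algK f : unlift_alg (lift_alg f) = f.
Proof. by apply/funext => a; rewrite /unlift_alg /lift_alg proj_elts. Qed.
Lemma lift_rboK f : unlift_rbo (lift_rbo f) = f.
Proof. by apply/funext => a; rewrite /unlift_rbo /lift_rbo proj_elts. Qed.
Lemma unlift_algK p F : is_hom p F -> lift_alg (unlift_alg F) = F.
Proof.
move=> hF; apply/funext => xs; rewrite (is_hom_elts xs hF) /lift_alg.
exact: shift_conc0_ext.
Qed.
Lemma unlift_rboK p F : is_hom p F -> lift_rbo (unlift_rbo F) = F.
Proof.
move=> hF; apply/funext => xs; rewrite (is_hom_elts xs hF) /lift_rbo.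
exact: conc0_ext.
Qed.

Lemma homog_unlift_alg p F : is_hom p F -> homog p (unlift_alg F).
Proof.
move=> hF; split=> [s t c x y|a ha]; rewrite /unlift_alg.
  rewrite !map_cat; exact: (elt_linear_eval 1 s t hF).
have h := hF.2 (map elt a) 1; rewrite tdeg_elts in h; apply: h; lia.
Qed.

Lemma homog_unlift_rbo p F : is_hom p F -> homog (p + 1) (unlift_rbo F).
Proof.
move=> hF; split=> [s t c x y|a ha]; rewrite /unlift_rbo.
  rewrite !map_cat; exact: (elt_linear_eval 0 s t hF).
have h := hF.2 (map elt a) 0; rewrite tdeg_elts in h; apply: h; lia.
Qed.

Definition lift_pair (z : (seq A -> A) * (seq A -> A)) : C_RBA V :=
  (lift_alg z.1, lift_rbo z.2).

Lemma in_coRBA_homog p (z : (seq A -> A) * (seq A -> A)) :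
  shift_complex (homological (@in_coRBA k A)) p z <->
  homog p z.1 /\ homog (p + 1) z.2.
Proof.
case: z => f g; rewrite /shift_complex /homological.
case E: (- (p - 1)) => [n|n].
  have -> : p = 1 - n%:Z by lia.
  rewrite /in_coRBA /=; split=> -[/homog_cochain hf hg]; split=> //.
    case: n E hf hg => [|n] E hf hg; first by rewrite hg; exact: homog0.
    have -> : 1 - n.+1%:Z + 1 = 1 - n%:Z by lia.
    exact/homog_cochain.
  case: n E hf hg => [|n] E hf hg.
    by apply/funext => a; apply: hg.2; lia.
  apply/homog_cochain; have <- : 1 - n.+1%:Z + 1 = 1 - n%:Z by lia.
  by [].
split=> [[-> ->]|[hf hg]]; first by split; exact: homog0.
by congr pair; apply/funext => a; [apply: hf.2|apply: hg.2]; lia.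
Qed.

Lemma in_RBA_lift_pair p (z : (seq A -> A) * (seq A -> A)) :
  homog p z.1 -> homog (p + 1) z.2 -> in_RBA p (lift_pair z).
Proof. by split; [exact: is_hom_lift_alg | exact: is_hom_lift_rbo]. Qed.

Lemma lift_pairK z : identification (lift_pair z) = z.
Proof. by rewrite identificationE /= lift_algK lift_rboK; case: z. Qed.

Lemma identificationK p (x : C_RBA V) : in_RBA p x -> lift_pair (identification x) = x.
Proof.
case=> h1 h2; rewrite identificationE /lift_pair /= (unlift_algK h1) (unlift_rboK h2).
by case: x {h1 h2}.
Qed.

Lemma homog_identification p (x : C_RBA V) : in_RBA p x ->
  homog p (identification x).1 /\ homog (p + 1) (identification x).2.
Proof.
case=> h1 h2; rewrite identificationE.
by split; [exact: homog_unlift_alg | exact: homog_unlift_rbo].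
Qed.

End Transfer.

(** * The fixed-arity brackets on extended maps *)

Section Evaluate.
Variables (k : fieldType) (lam : k) (A : lmodType k).
Local Notation V := (conc0 A).
Local Notation U := (shift (conc0 A)).
Implicit Types (f : seq A -> A) (a : seq A) (p q : int).

(** The summand of [l_fix] for one permutation, without the sign chi. It depends on
the permutation only through the permuted list hs. *)
Definition summand n p (sh : C_Alg V) (hs : seq (int * C_RBO V)) : C_RBO V :=
  let m := size hs in
  let e := m%:Z * p
           + \sum_(1 <= i < m) \sum_(0 <= j < i) [seq g.1 | g <- hs]`_j in
  if [seq susp_hom g | g <- hs] is sg1 :: sgs then
    let nested := desusp_hom
      (brace sg1.2 [:: (p + \sum_(g <- sgs) g.1, brace sh sgs)]) in
    if m == n then
      (-1 : k) ^ e *: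
        (desusp_hom (tcomp sh (sg1 :: sgs)) - (-1 : k) ^ (sg1.1 * p) *: nested)
    else if (m < n)%N then
      ((-1) ^ (1 + e + p * sg1.1) * lam ^+ (n - m)) *: nested
    else 0
  else 0.

Lemma size_permute (X : Type) (gs : seq X) (s : 'S_(size gs)) :
  size (permute s) = size gs.
Proof. by rewrite size_map size_enum_ord. Qed.

Lemma l_fixE n p (sh : C_Alg V) gs : l_fix lam n p sh gs =
  \sum_(s : 'S_(size gs))
    antikoszul k (fun i => (tnth (in_tuple gs) i).1) s *:
      summand n p sh (permute s).
Proof.
rewrite /l_fix; apply: eq_bigr => s _; rewrite /summand size_permute.
case: map => [|sg1 sgs]; first by rewrite scaler0.
case: ifP => _; first by rewrite -scalerA.
by case: ifP => _; rewrite ?scaler0 // !scalerA mulrA.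
Qed.

Lemma summand_gt n p (sh : C_Alg V) hs : (n < size hs)%N -> summand n p sh hs = 0.
Proof.
rewrite /summand; case: map => // sg1 sgs; case: ltngtP => //.
Qed.

Lemma l_fix_gt n p (sh : C_Alg V) gs : (n < size gs)%N -> l_fix lam n p sh gs = 0.
Proof.
move=> lt; rewrite l_fixE big1 // => s _.
by rewrite summand_gt ?scaler0 // size_permute.
Qed.

Definition tag_rbo (g : int * (seq A -> A)) : int * C_RBO V := (g.1, lift_rbo g.2).
Definition tag_susp (g : int * (seq A -> A)) := (g.1 + 1, g.2).

(** The counterpart of [summand] on ungraded functions. *)
Definition usummand n p f (gs : seq (int * (seq A -> A))) : seq A -> A :=
  let m := size gs in
  let e := m%:Z * p
           + \sum_(1 <= i < m) \sum_(0 <= j < i) [seq g.1 | g <- gs]`_j in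
  if [seq tag_susp g | g <- gs] is sg1 :: sgs then
    let nested := ubrace sg1.2 [:: (p + \sum_(g <- sgs) g.1, ubrace f sgs)] in
    if m == n then
      (-1 : k) ^ e *: (utcomp f (sg1 :: sgs) - (-1 : k) ^ (sg1.1 * p) *: nested)
    else if (m < n)%N then
      ((-1) ^ (1 + e + p * sg1.1) * lam ^+ (n - m)) *: nested
    else 0
  else 0.

Lemma susp_tag_rbo gs :
  [seq susp_hom g | g <- map tag_rbo gs] = map (@tag_alg _ A) (map tag_susp gs).
Proof. by rewrite -!map_comp; apply: eq_map. Qed.

Lemma summand_lift n p f gs : homog p f -> homogs (map tag_susp gs) ->
  summand n p (lift_alg f) (map tag_rbo gs) = lift_rbo (usummand n p f gs).
Proof.
move=> hf hgs; rewrite /summand /usummand susp_tag_rbo size_map -map_comp.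
rewrite (_ : [seq (fst \o tag_rbo) i | i <- gs] = [seq g.1 | g <- gs]) //.
case E: (map tag_susp gs) => [|[q g] gs'] /=; first by rewrite linear0.
rewrite E /= in hgs; case: hgs => hg hgs'.
have lf := hf.1.
have -> : brace (lift_alg g) [:: (p + \sum_(h <- map (@tag_alg _ A) gs') h.1,
            brace (lift_alg f) (map (@tag_alg _ A) gs'))] =
          lift_alg (ubrace g [:: (p + \sum_(h <- gs') h.1, ubrace f gs')]).
  rewrite brace_lift // big_map.
  rewrite -(brace_lift (gs := [:: (_, _)])) //; first exact: hg.1.
  by split=> //; exact: homog_ubrace.
have -> : tcomp (lift_alg f) ((q, lift_alg g) :: map (@tag_alg _ A) gs') =
  lift_alg (utcomp f ((q, g) :: gs')) by rewrite -tcomp_lift.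
rewrite !desusp_lift_alg; case: ifP => _; first by rewrite -linearZ -linearB -linearZ.
by case: ifP => _; rewrite ?linear0 // -linearZ.
Qed.

(** The degrees of the g are those of maps to A; suspending them adds 1. *)
Lemma homog_usummand n p f gs : homog p f -> homogs (map tag_susp gs) ->
  homog (p + \sum_(g <- gs) (g.1 + 1)) (usummand n p f gs).
Proof.
move=> hf; rewrite /usummand -(big_map tag_susp xpredT fst).
case: (map tag_susp gs) => [|[q g] gs'] hgs; first exact: homog0.
rewrite /=; have hn : homog (p + \sum_(g0 <- (q, g) :: gs') g0.1)
    (ubrace g [:: (p + \sum_(g0 <- gs') g0.1, ubrace f gs')]).
  have hu := homog_ubrace hf hgs.2.
  have := homog_ubrace (gs := [:: (_, _)]) hgs.1 (conj hu I).
  by rewrite big_seq1 big_cons addrCA.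
case: ifP => _; last by case: ifP => _; [exact: homogZ | exact: homog0].
by apply/homogZ/homogB; [exact: homog_utcomp | exact: homogZ].
Qed.

(** What is needed of the entries g_i for braces into them to kill zero arguments. *)
Definition lifted (h : int * C_RBO V) : Prop :=
  exists2 g, h.2 = lift_rbo g & multilinear g.

Lemma brace0 (W : graded k) (gs : seq (int * homT U U)) :
  brace (0 : homT U W) gs = 0.
Proof.
apply/funext => xs; rewrite /brace; move: [::] (0 : int) => pre c.
elim: gs pre c xs => [|[q g] gs IH] pre c xs //=.
by rewrite big1 // => i _; rewrite big1 // => l _; rewrite IH scaler0.
Qed.

Lemma tcomp0 (W : graded k) (gs : seq (int * homT U U)) :
  tcomp (0 : homT U W) gs = 0.
Proof.
apply/funext => xs; rewrite /tcomp; move: [::] (0 : int) => pre c.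
elim: gs pre c xs => [|[q g] gs IH] pre c xs /=; first by case: nilp.
by rewrite big1 // => l _; rewrite IH scaler0.
Qed.

Lemma brace_lift0 f q : multilinear f -> brace (lift_alg f) [:: (q, 0)] = 0.
Proof.
move=> lf; have := brace_lift lf (gs := [:: (q, 0)]).
rewrite /tag_alg /= linear0 => ->; last by split=> //; exact: homog0.
rewrite -[RHS](linear0 (@lift_alg _ A)); congr lift_alg; apply/funext => a.
by rewrite ubrace_arg0.
Qed.

Lemma summand0 n p hs : (forall i, lifted (nth (0, 0) hs i)) -> summand n p 0 hs = 0.
Proof.
rewrite /summand; case: hs => //= -[q h] hs /(_ 0%N)[/= g -> lg].
have -> : (fun xs => susp (lift_rbo g xs)) = lift_alg g by [].
rewrite brace0 brace_lift0 // tcomp0.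
have d0 : @desusp_hom k V 0 = 0.
  by rewrite -[0 in LHS](linear0 (@lift_alg _ A)) desusp_lift_alg linear0.
by rewrite d0 scaler0 subr0 !scaler0 !if_same.
Qed.

Lemma l_fix0 n p gs : (forall i, lifted (tnth (in_tuple gs) i)) ->
  l_fix lam n p 0 gs = 0.
Proof.
move=> hgs; rewrite l_fixE big1 // => s _; rewrite summand0 ?scaler0 // => i.
have [lti|gei] := ltnP i (size (permute s)); last first.
  rewrite nth_default //; exists 0; first by rewrite /= linear0.
  exact: (homog0 A 0).1.
rewrite size_permute in lti.
by rewrite (nth_map (Ordinal lti)) ?size_enum_ord.
Qed.

(** A map of degree 1 - n has arity n only, so the other arities contribute brackets
of the zero map. The bound on n comes from the range of summation. *)
Lemma l_mixed_exact n p f gs xs : p = 1 - n%:Z -> homog p f ->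
  (forall i, lifted (tnth (in_tuple gs) i)) ->
  l_mixed lam p (lift_alg f) gs xs =
  if (n <= size xs + size gs)%N then l_fix lam n p (lift_alg f) gs xs else 0.
Proof.
move=> -> hf hgs; rewrite /l_mixed.
have arE m : arity m (lift_alg f) = if m == n then lift_alg f else 0.
  apply/funext => ys; rewrite /arity; case: eqP => [eqm|nem].
    case: eqP => [//|nen]; rewrite /lift_alg hf.2 ?linear0 // size_map; lia.
  case: eqP => // eqn; rewrite /lift_alg hf.2 ?linear0 // size_map; lia.
have zero m : m != n -> l_fix lam m (1 - n%:Z) (arity m (lift_alg f)) gs xs = 0.
  by move=> /negbTE ne; rewrite arE ne l_fix0.
case: ifP => [le|gt].
  have lt : (n < (size xs + size gs).+1)%N by [].
  rewrite (bigD1 (Ordinal lt)) //= big1 ?addr0 ?arE ?eqxx // => i ne.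
  exact: zero.
rewrite big1 // => i _; apply: zero; move: (ltn_ord i) gt; lia.
Qed.

Lemma l_mixed0 p gs : (forall i, lifted (tnth (in_tuple gs) i)) ->
  l_mixed lam p 0 gs = 0.
Proof.
move=> hgs; apply/funext => xs; rewrite /l_mixed big1 // => i _.
rewrite (_ : arity i 0 = 0) ?l_fix0 //.
by apply/funext => ys; rewrite /arity if_same.
Qed.

End Evaluate.

(** * Brackets with the structure maps *)

Section AtAlpha.
Variables (k : fieldType) (lam : k) (A : lmodType k).
Variables (mu : {bilinear A -> A -> A}) (T : {linear A -> A}).
Local Notation V := (conc0 A).
Local Notation U := (shift (conc0 A)).
Local Notation utau := (-1 : int, opc T).
Local Notation tau := (-1 : int, lift_rbo (opc T)).
Implicit Types (f g : seq A -> A) (a : seq A) (p q : int).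

(** For inputs of degree 1 the Koszul sign of s^{-1} (x) s^{-1} cancels the minus sign
in the definition of m. *)
Lemma mc_mulE : mc_mul mu = lift_alg (mulc mu).
Proof.
apply/funext => -[|x [|y [|z xs]]]; rewrite /lift_alg /= ?linear0 //.
pose v : gtot U := susp (incl0 (mu (proj x) (proj y))).
change (- ((-1 : k) ^ (- tag x) *: v) = v).
have [gx|bx] := eqVneq (tag x) 1.
  have -> : (-1 : k) ^ (- tag x) = -1 by rewrite gx -[LHS]/((-1)^-1) invrN1.
  by rewrite scaleN1r opprK.
by rewrite /v (proj_off_deg1 bx) linear0l !linear0.
Qed.

Lemma mc_opE : mc_op T = lift_rbo (opc T).
Proof. by apply/funext => -[|x [|y xs]]; rewrite /lift_rbo /= ?linear0. Qed.

Lemma homogs_susp_tau n : homogs (map (@tag_susp k A) (nseq n utau)).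
Proof. by rewrite map_nseq; exact: homogs_nseq_opc. Qed.

(** All permutations of equal entries of odd degree contribute the same. *)
Lemma l_fix_tau n p f i : homog p f ->
  l_fix lam n p (lift_alg f) (nseq i tau) =
  i`!%:R *: lift_rbo (usummand lam n p f (nseq i utau)).
Proof.
move=> hf; rewrite l_fixE.
under eq_bigr => s _.
  rewrite antikoszul_odd; last first.
    by move=> j; rewrite (tnth_nth tau) /= nth_nseq if_same.
  rewrite scale1r.
  have -> : permute s = map (@tag_rbo _ A) (nseq i utau).
    rewrite map_nseq /tag_rbo /=; apply: (@eq_from_nth _ tau).
      by rewrite size_permute.
    rewrite size_permute => j lt_j.
    rewrite (nth_map (Ordinal lt_j)) ?size_enum_ord // (tnth_nth tau) /=.
    by rewrite !nth_nseq !if_same.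
  rewrite (summand_lift _ _ hf (homogs_susp_tau i)).
  over.
by rewrite sumr_const card_Sn size_nseq scaler_nat.
Qed.

Lemma l_fix_single n p f r g : homog p f -> homog (r + 1) g ->
  l_fix lam n p (lift_alg f) [:: (r, lift_rbo g)] =
  lift_rbo (usummand lam n p f [:: (r, g)]).
Proof.
move=> hf hg; rewrite l_fixE sum_S1 antikoszul1 scale1r -summand_lift //.
congr summand; rewrite /permute enum_ordSl enum_ord0 /= perm1.
by rewrite (tnth_nth (0, 0)).
Qed.

Lemma l_fix_pair n p f r1 g1 r2 g2 :
  homog p f -> homog (r1 + 1) g1 -> homog (r2 + 1) g2 ->
  l_fix lam n p (lift_alg f) [:: (r1, lift_rbo g1); (r2, lift_rbo g2)] =
  lift_rbo (usummand lam n p f [:: (r1, g1); (r2, g2)]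
            - (-1 : k) ^ (r1 * r2) *: usummand lam n p f [:: (r2, g2); (r1, g1)]).
Proof.
move=> hf h1 h2; rewrite l_fixE sum_S2 antikoszul1 antikoszul_tperm scale1r.
rewrite linearB linearZ /= -!summand_lift //= scaleNr.
congr (_ - _ *: _); congr summand.
  rewrite /permute 2!enum_ordSl enum_ord0 /= !perm1.
  by rewrite !(tnth_nth (0, 0)).
rewrite /permute 2!enum_ordSl enum_ord0 /=.
rewrite tpermL (_ : lift _ _ = 1) ?tpermR; last exact: val_inj.
by rewrite !(tnth_nth (0, 0)).
Qed.

(** The exponent of the sign is obtained from |tau| = -1, the double sum in it being
- 'C(i.+1, 2). *)
Lemma usummand_tau n p f i a : usummand lam n p f (nseq i.+1 utau) a =
  (-1) ^ (i.+1%:Z * p - 'C(i.+1, 2)%:Z) *: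
   (if i.+1 == n then
      utcomp f (nseq i.+1 (0, opc T)) a - T (ubrace f (nseq i (0, opc T)) a)
    else if (i.+1 < n)%N then
      - (lam ^+ (n - i.+1) *: T (ubrace f (nseq i (0, opc T)) a))
    else 0).
Proof.
have sumE : \sum_(1 <= j < i.+1) \sum_(0 <= l < j)
     [seq h.1 | h <- nseq i.+1 utau]`_l = - 'C(i.+1, 2)%:Z.
  rewrite -bin2_sum big_ltn // add0n -natz natr_sum -sumrN.
  apply: eq_big_nat => j /andP[_ ltj]; rewrite map_nseq.
  rewrite (eq_big_nat _ _ (F2 := fun=> -1)) => [|l /andP[_ ltl]].
    by rewrite sumr_const_nat subn0 mulNrn.
  by rewrite nth_nseq (ltn_trans ltl).
rewrite /usummand size_nseq sumE map_nseq /=.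
rewrite -[ (-1 + 1 : int)]/(0 : int).
case: eqP => [_|ne].
  by rewrite fun_scaleE fun_addE fun_oppE mul0r expr0z scale1r ubrace_opc.
case: ifP => _; last by rewrite scaler0.
rewrite fun_scaleE ubrace_opc mulr0 addr0 -scalerA scalerN -scaleNr; congr (_ *: _).
by rewrite expfzDr ?oppr_eq0 ?oner_eq0 // expr1z mulN1r.
Qed.

End AtAlpha.

(** * The cochain differentials as brace expressions *)

Section Pieces.
Variables (k : fieldType) (lam : k) (A : lmodType k).
Variables (mu : {bilinear A -> A -> A}) (T : {linear A -> A}).
Implicit Types (f g : seq A -> A) (a : seq A) (p q : int).
Local Notation utau := (-1 : int, opc T).

Lemma usummand_single p g : usummand lam 2 (-1) (mulc mu) [:: (p, g)] =
  ((-1) ^ (p + 1) * lam) *: ubrace g [:: (-1, mulc mu)].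
Proof.
rewrite /usummand /= big_nat big_pred0 => [|i]; last by case: i => [|[|i]].
rewrite big_nil !addr0 expr1 (@sign_congr k _ (p + 1) (- p - 1)) //.
by lia.
Qed.

Lemma usummand_pair r1 g1 r2 g2 :
  usummand lam 2 (-1) (mulc mu) [:: (r1, g1); (r2, g2)] =
  (-1) ^ r1 *: (utcomp (mulc mu) [:: (r1 + 1, g1); (r2 + 1, g2)]
     - (-1 : k) ^ (r1 + 1) *:
        ubrace g1 [:: (r2, ubrace (mulc mu) [:: (r2 + 1, g2)])]).
Proof.
rewrite /usummand /= !big_nat1 big_seq1 /=.
rewrite (@sign_congr k _ r1 (-1)); last by lia.
rewrite (@sign_congr k (_ * -1) (r1 + 1) (- (r1 + 1))); last by lia.
by rewrite [-1 + _]addrCA subrr addr0.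
Qed.

Lemma ubrace_mulc_opc x y :
  ubrace (mulc mu) [:: (0, opc T)] [:: x; y] = mu (T x) y + mu x (T y).
Proof.
by rewrite (ubrace_mulc _ (homog_opc T) (l := 1)) //= expr0z scale1r.
Qed.

(** Up to sign, the first summand is lambda times g with a product of two neighbours
inserted. The others give the outer terms, with the actions of a on x by
T(a) x - T(a x) and x T(a) - T(x a), and g with T(a) b + a T(b) inserted; this
and the first summand make up the terms with the product star. *)
Lemma partialE g p (N : nat) : p = - N%:Z -> homog (p + 1) g ->
  partial lam mu T N g =
  - usummand lam 2 (-1) (mulc mu) [:: (p, g)]
  - (usummand lam 2 (-1) (mulc mu) [:: utau; (p, g)]
     - (-1 : k) ^ (-1 * p) *: usummand lam 2 (-1) (mulc mu) [:: (p, g); utau]).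
Proof.
move=> pN hg; have lg := hg.1; apply/funext => a.
have [sa|nsa] := eqVneq (size a) N.+1; last first.
  rewrite /partial /hochschild (negbTE nsa).
  have zero gs : homogs (map (@tag_susp k A) gs) -> \sum_(h <- gs) (h.1 + 1) = p + 1 ->
      usummand lam 2 (-1) (mulc mu) gs a = 0.
    move=> hgs E; have [_] := homog_usummand lam 2 (homog_mulc mu) hgs; apply.
    by rewrite E; lia.
  have hu : homog (-1 + 1) (opc T) := homog_opc T.
  rewrite !(fun_addE, fun_oppE, fun_scaleE) !zero //= ?big_cons ?big_nil /=.
  - by rewrite scaler0 !subr0 oppr0.
  - by rewrite addNr !addr0.
  - by rewrite addNr add0r addr0.
  - by rewrite addr0.
rewrite /partial /hochschild sa eqxx.
rewrite usummand_single !usummand_pair !(fun_addE, fun_oppE, fun_scaleE).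
have hu := homog_opc T; have hm := homog_mulc mu.
have hmu : homog (-1) (ubrace (mulc mu) [:: (0, opc T)]).
  by have := homog_ubrace (gs := [:: (0, opc T)]) hm (conj hu I); rewrite big_seq1 addr0.
rewrite (ubrace_bin lg hm sa) -[(-1 + 1 : int)]/(0 : int) (ubrace_bin lg hmu sa).
have pq : p + 1 = 1 - N%:Z by lia.
rewrite ubrace_opc (ubrace_mulc mu hg pq sa).
case/lastP: a sa => // a z; rewrite size_rcons => -[sa].
rewrite utcomp_mulc_opr.
case E: (rcons a z) => [|x b]; first by case: (a) E.
rewrite utcomp_mulc_opl // -E.
have -> : take N (rcons a z) = a by rewrite -cats1 take_size_cat.
have -> : (rcons a z)`_N = z by rewrite nth_rcons sa ltnn eqxx.
have -> : behead (rcons a z) = b by rewrite E.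
have -> : (rcons a z)`_0 = x by rewrite E.
set S := \sum_(i < N) _ *: g (_ ++ (_ + _ + _) :: _).
set S1 := \sum_(i < N) _; set S2 := \sum_(i < N) _.
have s1 : (-1 : k) ^ (p + 1) = (-1) ^+ N.+1 by apply: signN1; exists (- N%:Z); lia.
(* Multilinearity of g splits the product star into its weight-lambda part and
   the two terms containing T. *)
have -> : S = - ((-1) ^ (p + 1) * lam) *: S1 - (-1) ^ (p + 1) *: S2.
  rewrite /S /S1 /S2 !scaler_sumr -sumrB; apply: eq_bigr => i _.
  rewrite ubrace_mulc_opc !multilinearD // multilinearZ // !scalerA.
  have lti := ltn_ord i.
  have E1 : (-1 : k) ^+ (N - i) = - ((-1) ^ (p + 1) * (-1) ^ (- i%:Z)).
    have <- : (-1 : k) ^ (1 + (p + 1 - i%:Z)) = (-1) ^+ (N - i).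
      by apply: signN1; exists (1 - N%:Z); lia.
    by rewrite signD expr1z mulN1r [in LHS]signD.
  rewrite E1 !scalerDr; set u := g _; set v := g _; set w := g _.
  rewrite [_ *: (lam *: w)]scalerA !mulNr !scaleNr opprD [_ * lam * _]mulrAC.
  by rewrite addrC [- (_ *: u) + _]addrC.
rewrite (_ : (-1 : k) ^ (-1 : int) = -1); last by rewrite -[LHS]/((-1)^-1) invrN1.
rewrite expr0z scale1r scaleN1r -s1.
rewrite [in RHS]scalerA -signD mulN1r addNr expr0z scale1r.
rewrite [T (_ + _)]linearD [T (_ *: _)]linearZ /= !scalerBr scaleNr.
rewrite [in RHS]opprD !opprK opprD !addrA.
by rewrite [LHS](ACl (3*1*6*2*5*4))%AC.
Qed.

Lemma deltaE f p (n : nat) : p = 1 - n%:Z -> homog p f ->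
  delta mu n f = ubrace (mulc mu) [:: (p, f)]
    - (-1 : k) ^ (-1 * p) *: ubrace f [:: (-1, mulc mu)].
Proof.
move=> pn hf; have lf := hf.1; have hm := homog_mulc mu; apply/funext => a.
have [sa|nsa] := eqVneq (size a) n.+1; last first.
  rewrite /delta /hochschild (negbTE nsa) !(fun_addE, fun_oppE, fun_scaleE).
  have [_ ->] := homog_ubrace (gs := [:: (p, f)]) hm (conj hf I); last first.
    by rewrite big_seq1 /=; lia.
  have [_ ->] := homog_ubrace (gs := [:: (-1, mulc mu)]) hf (conj hm I); last first.
    by rewrite big_seq1 /=; lia.
  by rewrite scaler0 subr0.
rewrite /delta /hochschild sa eqxx !(fun_addE, fun_oppE, fun_scaleE).
rewrite (ubrace_mulc mu hf pn sa) (ubrace_bin lf hm sa).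
have -> : (-1 : k) ^+ n.+1 = (-1) ^ p.
  by symmetry; apply: signN1; exists (- n%:Z); lia.
rewrite addrC addrA; congr (_ + _).
rewrite scaler_sumr -sumrN; apply: eq_bigr => i _.
rewrite scalerA -signD -scaleNr.
have <- : (-1 : k) ^ (1 + (-1 * p - i%:Z)) = (-1) ^+ (n - i).
  by apply: signN1; exists 0; move: (ltn_ord i); lia.
by rewrite [in LHS]signD expr1z !mulN1r.
Qed.

Lemma delta_mulc : associative mu -> delta mu 2 (mulc mu) = 0.
Proof.
move=> muA; apply/funext => a; rewrite /delta /hochschild.
case: eqP => //; case: a => [|x [|y [|z [|t a]]]] // _.
rewrite !big_ord_recl big_ord0 /= -[(2 - 0)%N]/2%N -[(2 - bump 0 0)%N]/1%N.
by rewrite exprS sqrrN expr1n mulr1 expr1 scale1r !scaleN1r muA !addr0 subrr addr0 addNr.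
Qed.

(** The term j = n of the sum, with T applied to n of the n.+1 inputs, has
coefficient 1; every further input left alone costs a factor lambda. *)
Lemma PhiE f n a : homog (1 - n.+1%:Z) f ->
  Phi lam T n.+1 f a =
  utcomp f (nseq n.+1 (0, opc T)) a
   - \sum_(j < n.+1) lam ^+ (n - j) *: T (ubrace f (nseq j (0, opc T)) a).
Proof.
move=> hf; have lf := hf.1; rewrite utcomp_opc // /Phi /=.
rewrite /ubrace; under [in RHS]eq_bigr => j _ do rewrite ubrace_rec_opc //=.
case: eqP => [sa|nsa]; last first.
  rewrite big1 ?subr0 // => j _; rewrite big1 ?linear0 ?scaler0 // => I _.
  by rewrite hf.2 // size_map size_enum_ord; lia.
rewrite -sa; congr (_ - _).
apply: eq_bigr => j _; have -> : (size a - j - 1 = n - j)%N by lia.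
by congr (_ *: _); rewrite [RHS]linear_sum.
Qed.

End Pieces.

(** * The bracket of copies of one element and another *)

Section RbaOp.
Variables (k : fieldType) (lam : k) (V : graded k).

Lemma rba_op_snd (xs : seq (int * C_RBA V)) : (1 < size xs)%N ->
  (rba_op lam xs).2 = \sum_(j < size xs)
    (-1 : k) ^ ((nth (0, 0) xs j).1 * (\sum_(y <- take j xs) y.1) + j%:Z) *:
    l_mixed lam (nth (0, 0) xs j).1 (nth (0, 0) xs j).2.1
      [seq (y.1, y.2.2) | y <- take j xs ++ drop j.+1 xs].
Proof.
case: xs => [|x [|y xs]] // _; rewrite /rba_op [LHS]/=.
by apply: eq_bigr => j _; rewrite (tnth_nth (0, 0)).
Qed.

(** The C_Alg entry is taken either from one of the copies of y, all i.+1 of which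
contribute equally because moving y past another y costs two signs, or from x. *)
Lemma rba_op_nseq_snd i (y x : C_RBA V) p :
  (rba_op lam (nseq i.+1 (-1, y) ++ [:: (p, x)])).2 =
  i.+1%:R *: l_mixed lam (-1) y.1 (nseq i (-1, y.2) ++ [:: (p, x.2)])
  + (-1) ^ (p * - i.+1%:Z + i.+1%:Z) *: l_mixed lam p x.1 (nseq i.+1 (-1, y.2)).
Proof.
set xs := _ ++ _; have sz : size xs = i.+2 by rewrite size_cat size_nseq addn1.
have sumN m : \sum_(z <- nseq m (-1 : int, y)) z.1 = - m%:Z.
  by rewrite big_nseq iter_addr addr0 mulNrn natz.
have nthx : nth (0, 0) xs i.+1 = (p, x) by rewrite nth_cat size_nseq ltnn subnn.
have nthy j : (j < i.+1)%N -> nth (0, 0) xs j = (-1, y).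
  by move=> lt_j; rewrite nth_cat size_nseq lt_j nth_nseq lt_j.
have tk m : (m <= i.+1)%N -> take m xs = nseq m (-1, y).
  by move=> le_m; rewrite takel_cat ?size_nseq // take_nseq.
have dr m : (m <= i.+1)%N -> drop m xs = nseq (i.+1 - m) (-1, y) ++ [:: (p, x)].
  move=> le_m; rewrite drop_cat size_nseq drop_nseq.
  by case: ltngtP le_m => // -> _; rewrite subnn.
move: xs sz nthx nthy tk dr => xs sz nthx nthy tk dr.
rewrite rba_op_snd ?sz // big_ord_recr /= nthx tk // sumN.
rewrite drop_oversize ?sz // cats0 map_nseq; congr (_ + _).
rewrite (eq_bigr (fun=> l_mixed lam (-1) y.1 (nseq i (-1, y.2) ++ [:: (p, x.2)]))).
  by rewrite sumr_const card_ord scaler_nat.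
move=> j _; have lt_j := ltn_ord j.
rewrite nthy // tk 1?ltnW // dr // sumN /=.
rewrite (@sign_congr k _ 0 j) ?expr0z ?scale1r; last by lia.
congr l_mixed; rewrite subSS catA -nseqD subnKC; last exact: lt_j.
by rewrite map_cat map_nseq.
Qed.

Lemma rba_op_nseq_fst i (y x : C_RBA V) p :
  (rba_op lam (nseq i (-1, y) ++ [:: (p, x)])).1 =
  if i == 1%N then gerstenhaber (-1, y.1) (p, x.1) else 0.
Proof. by case: i => [|[|[|i]]]. Qed.
End RbaOp.

(** * The brackets of the Maurer-Cartan element *)

Section Twist.
Variables (k : fieldType) (char_k : [pchar k] =i pred0) (lam : k) (A : lmodType k).
Variables (mu : {bilinear A -> A -> A}) (T : {linear A -> A}).
Local Notation V := (conc0 A).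
Implicit Types (f g : seq A -> A) (a : seq A) (p q : int).
Local Notation utau := (-1 : int, opc T).
Local Notation tau := (-1 : int, lift_rbo (opc T)).
Local Notation alpha := ((lift_alg (mulc mu), lift_rbo (opc T)) : C_RBA V).

(** The default entry of [nth] is tau, hence itself of this form. *)
Lemma lifted_tau_seq i (hs : seq (int * C_RBO V)) :
  (forall j, lifted (nth tau hs j)) ->
  forall j, lifted (tnth (in_tuple (nseq i tau ++ hs)) j).
Proof.
move=> hhs j; rewrite (tnth_nth tau) nth_cat nth_nseq; case: ifP => // _.
by rewrite if_same; exists (opc T) => //; exact: (homog_opc T).1.
Qed.

(** The bound on arities in [l_mixed_exact] is harmless: below it the list is too
short for [usummand] to be nonzero. *)
Lemma l_mixed_tau p n f i : p = 1 - n%:Z -> homog p f ->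
  l_mixed lam p (lift_alg f) (nseq i.+1 tau) =
  lift_rbo (i.+1`!%:R *: usummand lam n p f (nseq i.+1 utau)).
Proof.
move=> pn hf; apply/funext => xs; rewrite (l_mixed_exact lam xs pn hf); last first.
  rewrite -[nseq _ _]cats0; apply: lifted_tau_seq => j; rewrite nth_nil.
  by exists (opc T) => //; exact: (homog_opc T).1.
rewrite l_fix_tau // size_nseq linearZ; case: leqP => // gt.
change (0 = i.+1`!%:R *: lift_rbo (usummand lam n p f (nseq i.+1 utau)) xs).
rewrite /lift_rbo.
have hs := homogs_susp_tau T.
have [_ ->] := homog_usummand lam n hf (hs i.+1); first by rewrite linear0 scaler0.
rewrite big_nseq size_map; move: gt.
by rewrite iter_addr addNr mul0rn !addr0; lia.
Qed.

(** The bracket of m with i copies of tau and one g; it is 0 for i > 1 since m is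
binary. *)
Definition mul_term p g i : seq A -> A :=
  match i with
  | 0 => usummand lam 2 (-1) (mulc mu) [:: (p, g)]
  | 1 => usummand lam 2 (-1) (mulc mu) [:: utau; (p, g)]
         - (-1 : k) ^ (-1 * p) *: usummand lam 2 (-1) (mulc mu) [:: (p, g); utau]
  | _ => 0
  end.

Lemma l_mixed_mul p g i : homog (p + 1) g ->
  l_mixed lam (-1) (lift_alg (mulc mu)) (nseq i tau ++ [:: (p, lift_rbo g)]) =
  lift_rbo (mul_term p g i).
Proof.
move=> hg; have hm := homog_mulc mu; apply/funext => xs.
rewrite (l_mixed_exact (n := 2) lam xs _ hm) //; last first.
  apply: lifted_tau_seq => -[|j]; first by exists g => //; exact: hg.1.
  rewrite /= nth_nil; exists (opc T) => //; exact: (homog_opc T).1.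
rewrite size_cat size_nseq addn1; case: i => [|[|i]].
- rewrite l_fix_single //; case: leqP => // gt1.
  have -> : xs = [::] by apply/nilP; rewrite /nilp -leqn0; move: gt1; rewrite addn1.
  rewrite /lift_rbo /mul_term usummand_single fun_scaleE.
  by rewrite (ubrace1_small (l := 2)) ?scaler0 ?linear0 //; exact: hg.1.
- by rewrite l_fix_pair ?addnS //; exact: homog_opc.
- rewrite l_fix_gt ?if_same; last by rewrite size_cat size_nseq addn1.
  by rewrite linear0.
Qed.

Lemma mul_term0 p i : mul_term p 0 i = 0.
Proof.
have lm := (homog_mulc mu).1; have hu : homogs [:: (0, opc T)].
  by split=> //; exact: homog_opc.
case: i => [|[|i]] //=; first by rewrite usummand_single ubrace_zero scaler0.
rewrite !usummand_pair (utcomp_arg0r _ _ _ lm) ubrace_arg0 //.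
rewrite (utcomp_arg0l _ lm hu) ubrace_zero ubrace_arg0 ?(homog_opc T).1 //; last first.
  exact: (homog_opc T).1.
by rewrite !(scaler0, subr0).
Qed.

Lemma natf_inv n : (n`!%:R : k)^-1 * n`!%:R = 1.
Proof.
by apply: mulVf; rewrite (proj1 (pcharf0P k) char_k) -lt0n fact_gt0.
Qed.

(** The coefficient of l_{i+1}(alpha^i, x) in the twisted differential; the factor 1
is the number of arguments x. *)
Definition twist_coef i : k := (i`!%:R)^-1 * (-1) ^+ (i * 1 + 'C(i, 2)).

(** The bracket of f with i copies of tau, n = 1 - p being the arity of f. For i = 0
it is l_1, which only sees arity 0. *)
Definition tau_term p f i : seq A -> A :=
  if - (p - 1) is Posz n then
    if i is i'.+1 then i`!%:R *: usummand lam n p f (nseq i utau)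
    else if n == 0 then f else 0
  else 0.

Lemma rba_op_alpha_snd p f g i : homog p f -> homog (p + 1) g ->
  (rba_op lam (nseq i (-1, alpha) ++ [:: (p, (lift_alg f, lift_rbo g) : C_RBA V)])).2
  = lift_rbo ((if i is j.+1 then i%:R *: mul_term p g j else 0)
      + (-1) ^ (p * - i%:Z + i%:Z) *: tau_term p f i).
Proof.
move=> hf hg; case: i => [|i].
  rewrite /= arity_lift_alg desusp_lift_alg mulr0 expr0z scale1r add0r; congr lift_rbo.
  apply/funext => a; rewrite /tau_term.
  case E: (- (p - 1)) => [n|n].
    case: (n =P 0%N) => [n0|n0]; case: (size a =P 0%N) => // sa.
      by symmetry; apply: hf.2; lia.
    by apply: hf.2; rewrite sa; lia.
  by case: eqP => // sa; apply: hf.2; rewrite sa; lia.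
rewrite rba_op_nseq_snd l_mixed_mul // linearD linearZ linearZ; congr (_ + _ *: _).
rewrite /tau_term /=; case E: (- (p - 1)) => [n|n].
  by rewrite (l_mixed_tau (n := n)) //; lia.
have -> : f = 0 by apply/funext => a; apply: hf.2; lia.
rewrite linear0 l_mixed0 ?linear0 // -[nseq _ _]cats0.
apply: (@lifted_tau_seq i.+1 [::]) => j; rewrite nth_nil.
by exists (opc T) => //; exact: (homog_opc T).1.
Qed.
End Twist.

(** * Summing the twisted differential *)

Section Twisting.
Variables (k : fieldType) (char_k : [pchar k] =i pred0) (lam : k) (A : lmodType k).
Variables (mu : {bilinear A -> A -> A}) (T : {linear A -> A}).
Local Notation V := (conc0 A).
Implicit Types (f g : seq A -> A) (a : seq A) (p q : int).
Local Notation utau := (-1 : int, opc T).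
Local Notation alpha := ((lift_alg (mulc mu), lift_rbo (opc T)) : C_RBA V).

(** The factor i counts the copies of m that can be the C_Alg entry. *)
Definition mul_part p g i : seq A -> A :=
  if i is j.+1 then i%:R *: mul_term lam mu T p g j else 0.

Definition twist_term p f g i : seq A -> A :=
  twist_coef k i *:
    (mul_part p g i + (-1) ^ (p * - i%:Z + i%:Z) *: tau_term lam T p f i).

Lemma homog_mul_part p g i : homog (p + 1) g -> homog p (mul_part p g i).
Proof.
move=> hg; have hm := homog_mulc mu; have hu : homog (-1 + 1) (opc T) := homog_opc T.
have key gs : homogs (map (@tag_susp k A) gs) -> \sum_(h <- gs) (h.1 + 1) = p + 1 ->
    homog p (usummand lam 2 (-1) (mulc mu) gs).
  by move=> hgs E; have := homog_usummand lam 2 hm hgs; rewrite E addrCA subrr addr0.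
case: i => [|[|[|i]]]; rewrite /mul_part; try exact: homog0.
- apply/homogZ/key => //; by rewrite big_seq1.
- apply/homogZ/homogB; [|apply: homogZ]; apply: key => //;
  by rewrite !big_cons big_nil /= ?addNr ?addr0 ?add0r.
- by rewrite scaler0; exact: homog0.
Qed.

Lemma homog_tau_term p f i : homog p f -> homog p (tau_term lam T p f i).
Proof.
move=> hf; rewrite /tau_term; case: (- (p - 1)) => n; last exact: homog0.
case: i => [|i]; first by case: ifP => _ //; exact: homog0.
have hs := homogs_susp_tau T.
have := homog_usummand lam n hf (hs i.+1).
rewrite big_nseq iter_addr addNr mul0rn !addr0; exact: homogZ.
Qed.

Lemma homog_twist_term p f g i : homog p f -> homog (p + 1) g ->
  homog p (twist_term p f g i).
Proof.
move=> hf hg; apply/homogZ/homogD; first exact: homog_mul_part.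
exact/homogZ/homog_tau_term.
Qed.

Lemma twist_coef1 : twist_coef k 1 = -1.
Proof. by rewrite /twist_coef invr1 mul1r bin_small. Qed.

Lemma twist_coef2 : twist_coef k 2 * 2%:R = -1.
Proof.
rewrite /twist_coef mulrAC (natf_inv char_k 2) mul1r binn.
by rewrite -signr_odd.
Qed.

Lemma sum_mul_part p g n : \sum_(i < n.+3) twist_coef k i *: mul_part p g i =
  - mul_term lam mu T p g 0 - mul_term lam mu T p g 1.
Proof.
rewrite 3!big_ord_recl big1 => [|i _]; last by rewrite /= scaler0 scaler0.
rewrite addr0 /= scaler0 add0r scale1r twist_coef1 scaleN1r scalerA twist_coef2.
by rewrite scaleN1r.
Qed.

(** The three signs and i! cancel, whence the condition on the characteristic. *)
Lemma tau_coef p n f i a : p = 1 - n%:Z ->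
  (twist_coef k i.+1 *: ((-1) ^ (p * - i.+1%:Z + i.+1%:Z) *: tau_term lam T p f i.+1)) a =
   if i.+1 == n then
      utcomp f (nseq i.+1 (0, opc T)) a - T (ubrace f (nseq i (0, opc T)) a)
    else if (i.+1 < n)%N then
      - (lam ^+ (n - i.+1) *: T (ubrace f (nseq i (0, opc T)) a))
    else 0.
Proof.
move=> pn; rewrite /tau_term; have -> : - (p - 1) = n%:Z by lia.
rewrite !fun_scaleE usummand_tau !scalerA -[RHS]scale1r; congr (_ *: _).
rewrite /twist_coef exprnP.
set x := (i.+1`!%:R : k); set u := (-1 : k) ^ _; set v := _ ^ _; set w := _ ^ _.
transitivity ((x^-1 * x) * (u * v * w)); first by ring.
rewrite natf_inv // mul1r -!signD -[RHS](expr0z (-1)).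
apply: (@sign_congr _ _ _ i.+1%:Z); ring.
Qed.

Lemma sum_tau_term p n f : p = 1 - n%:Z -> homog p f ->
  \sum_(i < n.+3) twist_coef k i *: ((-1) ^ (p * - i%:Z + i%:Z) *: tau_term lam T p f i)
  = Phi lam T n f.
Proof.
move=> pn hf; rewrite big_ord_recl mulr0 expr0z scale1r.
have -> : twist_coef k 0 = 1 by rewrite /twist_coef invr1 mul1r expr0.
rewrite scale1r; apply/funext => a; rewrite fun_addE.
have sumE (I : finType) (F : I -> seq A -> A) : (\sum_i F i) a = \sum_i F i a.
  by elim/big_ind2: _ => // ? ? ? ? <- <-.
rewrite sumE; under eq_bigr => i _ do rewrite (tau_coef f i a pn).
rewrite /tau_term; have -> : - (p - 1) = n%:Z by lia.
case: n pn => [|n] pn; first by rewrite big1 ?addr0.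
(* The terms i = n.+1 and i = n.+2 vanish; i = n, bracketing f with as many copies
   of tau as it has inputs, supplies T on all inputs and the last summand of Phi. *)
rewrite PhiE -?pn // 3!big_ord_recr /= eqxx.
have -> : (n.+2 == n.+1) = false by lia.
have -> : (n.+3 == n.+1) = false by lia.
have -> : (n.+2 < n.+1)%N = false by lia.
have -> : (n.+3 < n.+1)%N = false by lia.
rewrite [0 a]/(0 : A) add0r !addr0.
rewrite [X in _ = _ - X]big_ord_recr /= subnn expr0 scale1r opprD [LHS]addrC.
rewrite [RHS]addrA [RHS]addrAC; congr (_ + _); rewrite -sumrN; apply: eq_bigr => i _.
have lt_i := ltn_ord i.
by rewrite eqSS ltnS lt_i ltn_eqF // subSS.
Qed.

(** In arity 0 the component g has degree 1 and is zero, so only Phi is left. *)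
Lemma sum_twist_term p n f g : p = 1 - n%:Z -> homog p f -> homog (p + 1) g ->
  \sum_(i < n.+3) twist_term p f g i =
  (if n is N.+1 then partial lam mu T N g else 0) + Phi lam T n f.
Proof.
move=> pn hf hg; rewrite /twist_term; under eq_bigr => i _ do rewrite scalerDr.
rewrite big_split sum_mul_part (sum_tau_term pn hf); congr (_ + _).
case: n pn => [|N] pn.
  have -> : g = 0 by apply/funext => a; apply: hg.2; lia.
  by rewrite !mul_term0 subr0 oppr0.
by rewrite (partialE _ _ _ _ hg) //; lia.
Qed.

Lemma twist_term_eq0 p n f g i : p = 1 - n%:Z -> homog p f -> homog (p + 1) g ->
  (2 < i)%N -> (n < i)%N -> twist_term p f g i = 0.
Proof.
move=> pn hf hg; case: i => [|[|[|i]]] // _ le_i; apply/funext => a.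
rewrite /twist_term /mul_part [mul_term _ _ _ _ _ _]/= scaler0 add0r.
rewrite (tau_coef f i.+2 a pn).
have -> : (i.+3 == n) = false by lia.
by have -> : (i.+3 < n)%N = false by lia.
Qed.

(** The C_Alg component of the i-th term; l_2 is the only operation having one. *)
Definition lie_part p f i : seq A -> A :=
  if i == 1%N then
    - (ubrace (mulc mu) [:: (p, f)]
       - (-1 : k) ^ (-1 * p) *: ubrace f [:: (-1, mulc mu)])
  else 0.

Lemma twisted_termE p f g i : homog p f -> homog (p + 1) g ->
  twist_coef k i *: rba_op lam (nseq i (-1, alpha) ++ [:: (p, lift_pair (f, g))]) =
  lift_pair (lie_part p f i, twist_term p f g i).
Proof.
move=> hf hg; have hm := homog_mulc mu.
have fstZ (c : k) (z : C_RBA V) : (c *: z).1 = c *: z.1 by [].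
have sndZ (c : k) (z : C_RBA V) : (c *: z).2 = c *: z.2 by [].
apply: injective_projections.
  rewrite fstZ rba_op_nseq_fst /lie_part [RHS]/=.
  case: eqP => [->|_]; last by rewrite scaler0 linear0.
  rewrite twist_coef1 scaleN1r linearN; congr (- _).
  rewrite /gerstenhaber linearB /= [lift_alg (_ *: _)]linearZ /=.
  have -> := brace_lift (gs := [:: (p, f)]) hm.1 (conj hf I).
  by have -> := brace_lift (gs := [:: (-1, mulc mu)]) hf.1 (conj hm I).
by rewrite sndZ rba_op_alpha_snd // -linearZ.
Qed.

Lemma delta_lie p n f : p = 1 - n%:Z -> homog p f -> lie_part p f 1 = - delta mu n f.
Proof. by move=> pn hf; rewrite /lie_part /= (deltaE _ pn hf). Qed.

Lemma homog_lie_part p f i : homog p f -> homog (p - 1) (lie_part p f i).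
Proof.
move=> hf; have hm := homog_mulc mu; rewrite /lie_part.
case: ifP => _; last exact: homog0.
apply/homogN/homogB.
  by have := homog_ubrace (gs := [:: (p, f)]) hm (conj hf I); rewrite big_seq1 addrC.
have := homog_ubrace (gs := [:: (-1, mulc mu)]) hf (conj hm I).
by rewrite big_seq1; exact: homogZ.
Qed.

(** The i-th term vanishes once i > 2, so that m no longer contributes, and i > n, so
that f does not either; hence n.+3 terms suffice. In degrees p > 1 everything is zero. *)
Lemma twisted_has_sum p f g : homog p f -> homog (p + 1) g ->
  twisted_op (rba_op lam (V := V)) (alpha : C_RBA V) [:: (p, lift_pair (f, g))]
    (lift_pair (shift_diff (homological_diff (d_coRBA lam mu T)) p (f, g))).
Proof.
move=> hf hg; rewrite /twisted_op /shift_diff /homological_diff.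
case E: (- (p - 1)) => [n|n]; last first.
  have f0 : f = 0 by apply/funext => a; apply: hf.2; lia.
  have g0 : g = 0 by apply/funext => a; apply: hg.2; lia.
  have zero : lift_pair (0 : seq A -> A, 0 : seq A -> A) = 0.
    by rewrite /lift_pair /= !linear0.
  exists 0%N; rewrite big_ord0 oppr0; split=> [i _|]; last exact: zero.
  rewrite (twisted_termE i hf hg) /lie_part /twist_term /tau_term E f0 g0.
  rewrite ubrace_zero ubrace_arg0 ?(homog_mulc mu).1 //; last exact: (homog_mulc mu).1.
  rewrite !scaler0 subr0 oppr0 if_same addr0 -zero; congr (lift_pair (_, _)).
  by case: i => [|i]; rewrite /= ?mul_term0 !scaler0.
have pn : p = 1 - n%:Z by lia.
exists n.+3; split=> [i le_i|].
  rewrite (twisted_termE i hf hg) (twist_term_eq0 (n := n)) //; try lia.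
  by case: i le_i => [|[|i]] //= _; rewrite /lie_part /= /lift_pair /= !linear0.
rewrite (eq_bigr (fun i : 'I_n.+3 =>
  lift_pair (lie_part p f i, twist_term p f g i))); last first.
  by move=> i _; rewrite -(twisted_termE i hf hg).
apply: injective_projections.
  rewrite raddf_sum /= -linear_sum; congr lift_alg.
  rewrite (bigD1 1) //= big1 ?addr0; last by case=> -[|[|i]] // lti.
  by rewrite (delta_lie pn hf).
rewrite raddf_sum /= -linear_sum; congr lift_rbo.
rewrite (sum_twist_term pn hf hg).
case: n {E pn} => [|n]; first by rewrite opprD opprK oppr0.
by rewrite opprD !opprK.
Qed.

(** The differential inherits multilinearity from the braces it is a sum of. *)
Lemma homog_shift_diff p (z : (seq A -> A) * (seq A -> A)) :
  homog p z.1 -> homog (p + 1) z.2 ->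
  let w := shift_diff (homological_diff (d_coRBA lam mu T)) p z in
  homog (p - 1) w.1 /\ homog (p - 1 + 1) w.2.
Proof.
case: z => f g hf hg; rewrite /shift_diff /homological_diff.
case E: (- (p - 1)) => [n|n]; last by rewrite oppr0; split; exact: homog0.
have pn : p = 1 - n%:Z by lia.
rewrite subrK; split.
  by rewrite /= -(delta_lie pn hf); exact: homog_lie_part.
have -> : (- d_coRBA lam mu T n (f, g)).2 = \sum_(i < n.+3) twist_term p f g i.
  rewrite (sum_twist_term pn hf hg) /=.
  by case: n {E pn} => [|n]; rewrite ?opprD ?opprK // oppr0.
by apply: homog_sum => i _; exact: homog_twist_term.
Qed.

End Twisting.

(** * The Maurer-Cartan equation *)

Section MaurerCartan.
Variables (k : fieldType) (char_k : [pchar k] =i pred0) (lam : k) (A : lmodType k).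
Variables (mu : {bilinear A -> A -> A}) (T : {linear A -> A}).
Local Notation V := (conc0 A).
Implicit Types (f g : seq A -> A) (a : seq A) (p q : int).
Local Notation utau := (-1 : int, opc T).
Local Notation alpha := ((lift_alg (mulc mu), lift_rbo (opc T)) : C_RBA V).

(** On two inputs the first summand is lambda T(xy), and the second is
T(T(x) y + x T(y)) - T(x) T(y). *)
Lemma rota_baxter_terms : rota_baxter lam mu T ->
  usummand lam 2 (-1) (mulc mu) [:: utau]
  + usummand lam 2 (-1) (mulc mu) [:: utau; utau] = 0.
Proof.
move=> RB; apply/funext => a; rewrite fun_addE.
rewrite -[[:: utau]]/(nseq 1 utau) (usummand_tau lam T 2 (-1) _ 0).
rewrite -[[:: utau; utau]]/(nseq 2 utau) (usummand_tau lam T 2 (-1) _ 1) /=.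
have -> : utcomp (mulc mu) [:: (0, opc T); (0, opc T)] a =
    if size a == 2 then mulc mu (map T a) else 0.
  exact: (utcomp_opc T 2 a (homog_mulc mu).1).
rewrite binn bin_small // mul1r subr0 -[X in X *: _]/((-1)^-1) invrN1 scaleN1r opprK.
rewrite (@sign_congr k _ 1 (-2)) // expr1z scaleN1r expr1.
have hm := homog_mulc mu; have hu := homog_opc T.
have [sa|nsa] := eqVneq (size a) 2; last first.
  have nsa1 : (size a)%:Z - 1 != 1 by move: nsa; lia.
  have -> : ubrace (mulc mu) [::] a = 0 by exact: hm.2.
  have [_ ->] := homog_ubrace (gs := [:: (0, opc T)]) hm (conj hu I); last first.
    by rewrite big_seq1 /=; move: nsa; lia.
  by rewrite !linear0 addr0 subrr.
case: a sa => [|x [|y [|z a]]] // _.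
rewrite [X in T X]/(mu x y) /= ubrace_mulc_opc RB [mu x (T y) + _]addrC.
rewrite [T (_ + lam *: _)]linearD [T (lam *: _)]linearZ /=.
by rewrite [_ + lam *: _]addrC -addrA subrr addr0 subrr.
Qed.

Lemma twist_term1 : twist_term lam mu T (-1) (mulc mu) (opc T) 1 =
  - (2%:R *: usummand lam 2 (-1) (mulc mu) [:: utau]).
Proof.
set U1 := usummand _ _ _ _ _.
have -> : twist_term lam mu T (-1) (mulc mu) (opc T) 1 =
  twist_coef k 1 *: (1 *: U1 + (-1) ^ (-1 * - 1%:Z + 1%:Z) *: (1 *: U1)) by [].
rewrite twist_coef1 scaleN1r (@sign_congr k _ 0 1) // expr0z !scale1r.
by rewrite scaler_nat mulr2n.
Qed.

(** The factor 3 collects the three ways of choosing which copy of alpha provides m. *)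
Lemma twist_term2 : twist_term lam mu T (-1) (mulc mu) (opc T) 2 =
  - (3%:R *: usummand lam 2 (-1) (mulc mu) [:: utau; utau]).
Proof.
set U2 := usummand _ _ _ _ _.
have -> : twist_term lam mu T (-1) (mulc mu) (opc T) 2 =
  twist_coef k 2 *: (2%:R *: (U2 - (-1) ^ (-1 * -1 : int) *: U2)
     + (-1) ^ (-1 * - 2%:Z + 2%:Z) *: (2%:R *: U2)) by [].
rewrite (@sign_congr k (-1 * -1) 1 0) // expr1z scaleN1r opprK.
rewrite (@sign_congr k _ 0 2) // expr0z scale1r -scalerDr scalerA twist_coef2 //.
by rewrite scaleN1r scaler_nat !mulrS mulr0n addr0 addrA.
Qed.

(** As (i + 1)! = (i + 1) i! and 'C(i + 1, 2) = 'C(i, 2) + i, the term with i + 1 copies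
of alpha is 1 / (i + 1) times the i-th term of the differential twisted by alpha,
applied to alpha. *)
Lemma maurer_cartan_alpha : associative mu -> rota_baxter lam mu T ->
  maurer_cartan (@in_RBA k V) (rba_op lam (V := V)) (alpha : C_RBA V).
Proof.
move=> muA RB; have hm := homog_mulc mu.
have hu : homog (-1 + 1) (opc T) := homog_opc T.
split; first exact: (@in_RBA_lift_pair k A (-1) (mulc mu, opc T) hm hu).
have termE i : ((i.+1`!%:R : k)^-1 * (-1) ^+ 'C(i.+1, 2)) *:
    rba_op lam (nseq i.+1 (-1, alpha)) =
  (i.+1%:R)^-1 *: lift_pair (lie_part mu (-1) (mulc mu) i,
                             twist_term lam mu T (-1) (mulc mu) (opc T) i).
  rewrite -(twisted_termE lam mu T i hm hu) -addn1 nseqD scalerA; congr (_ *: _).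
  rewrite addn1 binS bin1 factS natrM invfM /twist_coef muln1 addnC mulrA.
  by [].
have term0 i : twist_term lam mu T (-1) (mulc mu) (opc T) i.+3 = 0.
  by apply: (twist_term_eq0 char_k lam mu T (n := 2)).
exists 3%N; split=> [i le_i|].
  rewrite [LHS](termE i); case: i le_i => [|[|[|i]]] // _.
  by rewrite term0 /lie_part /= /lift_pair /= !linear0.
rewrite (eq_bigr (fun i : 'I_3 => (i.+1%:R)^-1 *: lift_pair (lie_part mu (-1) (mulc mu) i,
   twist_term lam mu T (-1) (mulc mu) (opc T) i))); last by move=> i _; exact: termE.
have natf_neq0 m : (m.+1%:R : k) != 0 by rewrite (proj1 (pcharf0P k) char_k).
apply: injective_projections.
  rewrite raddf_sum big1 // => i _.
  change ((i.+1%:R : k)^-1 *: lift_alg (lie_part mu (-1) (mulc mu) i) = 0).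
  have -> : lie_part mu (-1) (mulc mu) i = 0.
    case: i => -[|[|[|]]] //= _; rewrite (delta_lie mu (n := 2)) // delta_mulc //.
    by rewrite oppr0.
  by rewrite !linear0.
rewrite raddf_sum (eq_bigr (fun i : 'I_3 => lift_rbo
   ((i.+1%:R)^-1 *: twist_term lam mu T (-1) (mulc mu) (opc T) i))); last first.
  by move=> i _; rewrite linearZ.
rewrite -linear_sum [LHS]/= -[LHS](linear0 (@lift_rbo k A)); congr lift_rbo.
have sum3 (F : nat -> seq A -> A) : \sum_(i < 3) F i = F 0%N + F 1%N + F 2%N.
  by rewrite !big_ord_recr big_ord0 /= add0r.
rewrite (sum3 (fun i => (i.+1%:R)^-1 *: twist_term lam mu T (-1) (mulc mu) (opc T) i)).
have -> : twist_term lam mu T (-1) (mulc mu) (opc T) 0 = 0.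
  by rewrite /twist_term /= !scaler0 addr0 scaler0.
rewrite twist_term1 twist_term2.
have cancel m (u : seq A -> A) : (m.+1%:R : k)^-1 *: (- (m.+1%:R *: u)) = - u.
  by rewrite scalerN scalerA mulVf // scale1r.
rewrite scaler0 add0r (cancel 1%N) (cancel 2%N) -opprD rota_baxter_terms //.
by rewrite oppr0.
Qed.
End MaurerCartan.

(** * The shifted cochain complex is the twisted one *)

Theorem proposition8p3 (k : fieldType) (char_k : [pchar k] =i pred0) (lam : k)
  (A : lmodType k) (mu : {bilinear A -> A -> A}) (T : {linear A -> A})
  (mu_assoc : associative mu) (T_RB : rota_baxter lam mu T) :
  let alpha : C_RBA (conc0 A) := (mc_mul mu, mc_op T) in
  let sC := shift_complex (homological (@in_coRBA k A)) in
  let sd := shift_diff (homological_diff (d_coRBA lam mu T)) in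
  [/\ maurer_cartan (@in_RBA k (conc0 A)) (@rba_op k lam (conc0 A)) alpha,
      linear (@identification k A),
      forall (p : int) (x : C_RBA (conc0 A)),
        in_RBA p x -> sC p (identification x),
      forall (p : int) (z : (seq A -> A) * (seq A -> A)),
        sC p z -> exists! x : C_RBA (conc0 A),
          in_RBA p x /\ identification x = z
    & forall (p : int) (x : C_RBA (conc0 A)), in_RBA p x ->
        exists y : C_RBA (conc0 A),
          [/\ twisted_op (@rba_op k lam (conc0 A)) alpha [:: (p, x)] y,
              in_RBA (p - 1) y
            & identification y = sd p (identification x)]].
Proof.
rewrite mc_mulE mc_opE; move=> alpha sC sd; split.
- exact: maurer_cartan_alpha.
- by move=> c x y; rewrite !identificationE.
- by move=> p x /homog_identification hx; apply/in_coRBA_homog.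
- move=> p z /in_coRBA_homog[hf hg]; exists (lift_pair z); split.
    by split; [exact: in_RBA_lift_pair | exact: lift_pairK].
  by move=> x [hx <-]; exact: identificationK hx.
move=> p x hx; have [hf hg] := homog_identification hx.
exists (lift_pair (sd p (identification x))); split; last exact: lift_pairK.
  rewrite -{1}(identificationK hx).
  move: hf hg; case: (identification x) => f g; exact: twisted_has_sum.
by have [h1 h2] := homog_shift_diff char_k lam mu T hf hg; exact: in_RBA_lift_pair.
Qed.
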